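(* Let $\alpha>0$ be real and $d\in\mathbb{N}$. There exists $N_d(\alpha)$ such that for all integers $n>N_d(\alpha)$ the Jensen polynomial $J_{p_\alpha}^{d,n}(X)=\sum_{j=0}^{d}\binom{d}{j}p_\alpha(n+j)X^j$ is hyperbolic, i.e. has only real roots.
   Context: For real $\alpha$, $p_\alpha(n)$ is defined by $\prod_{k=1}^\infty (1-x^k)^{-\alpha}=\sum_{n\ge 0}p_\alpha(n)x^n$ (formal power series). *)

(* Defs.v *)
From mathcomp Require Import all_boot all_order all_algebra.
From mathcomp Require Import complex.
From mathcomp Require Import reals.

Set Implicit Arguments.
Unset Strict Implicit.
Unset Printing Implicit Defensive.

Import Order.TTheory GRing.Theory Num.Theory.
Local Open Scope ring_scope.

(* A formal power series is represented by its sequence of coefficients. *)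
Section FormalPowerSeries.
Variable R : realType.

Definition fps_one : nat -> R := fun n => (n == 0%N)%:R.

Definition fps_mul (f g : nat -> R) : nat -> R :=
  fun n => \sum_(i < n.+1) f i * g (n - i)%N.

Definition gbinomial (a : R) (j : nat) : R :=
  (\prod_(i < j) (a - i%:R)) / j`!%:R.

(* For k >= 1, the binomial series
   (1 - x^k)^a = \sum_j gbinomial a j * (-x^k)^j. *)
Definition one_sub_Xn_pow (k : nat) (a : R) : nat -> R :=
  fun m => if (k %| m)%N then (-1) ^+ (m %/ k) * gbinomial a (m %/ k) else 0.

(* \prod_(1 <= k <= K) (1 - x^k)^(-alpha) *)
Fixpoint euler_partial_prod (alpha : R) (K : nat) : nat -> R :=
  if K is K'.+1
  then fps_mul (euler_partial_prod alpha K') (one_sub_Xn_pow K (- alpha))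
  else fps_one.

(* The coefficient of x^n in the infinite product: by
   [euler_partial_prod_stable], it is the value at which the coefficients of
   x^n in the partial products are stationary. *)
Definition palpha (alpha : R) (n : nat) : R := euler_partial_prod alpha n n.

Lemma euler_partial_prod_stable (alpha : R) (K n : nat) :
  (n <= K)%N -> euler_partial_prod alpha K n = palpha alpha n.
Proof.
elim: K => [|K IHK]; first by rewrite leqn0 => /eqP ->.
rewrite leq_eqVlt => /orP[/eqP -> //|]; rewrite ltnS => le_nK.
rewrite -IHK //= /fps_mul big_ord_recr /= subnn big1 ?add0r.
  by rewrite /one_sub_Xn_pow dvdn0 div0n expr0 /gbinomial big_ord0 !(divr1, mulr1).
move=> i _; rewrite /one_sub_Xn_pow gtnNdvd ?mulr0 ?subn_gt0 //.
by rewrite ltnS (leq_trans (leq_subr _ _)).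
Qed.

Definition jensen_poly (p : nat -> R) (d n : nat) : {poly R} :=
  \poly_(j < d.+1) ('C(d, j)%:R * p (n + j)%N).

Definition hyperbolic (P : {poly R}) : Prop :=
  forall z : R[i], root (map_poly (real_complex R) P) z ->
    exists x : R, z = real_complex R x.

End FormalPowerSeries.

(* Main.v *)
(* Tilt the coefficients: a_j = p_alpha(j) r^j has generating function A with
   X A' = W A, where W = sum_k alpha sigma(k) r^k X^k, and choose r (the saddle
   point) so that W(1) = n + d =: n'.  Expanded in powers of X + 1, the rescaled
   Jensen polynomial has as coefficients the differences
   D_m = [X^n'] (1 - X)^m A.  Expanding W to second order at 1 in X A' = W A gives
   V D_(m+2) = - (m+1) (D_m - D_(m+1)) + error, with V = W'(1).  Hence the numbers
   V^(m/2) D_m / a_n' tend to the values at 0 of the Hermite polynomials, and the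
   rescaled Jensen polynomial tends to the d-th Hermite polynomial, whose roots
   are real and simple.
   The error is controlled by |D_m| = O(V^(-(m+1)/2)) A(1), obtained by splitting
   off from A the factors exp(c (X^L + ... + X^(3L-1))), m + 1 times, with
   r^L about 1/2, and by a_n' >= const V^(-1/2) A(1), which follows from
   Chebyshev's inequality.  All sums are finite: A and W are truncated at a
   degree N of order n'^2. *)
Require Import Defs.
From mathcomp Require Import all_boot all_order all_algebra.
From mathcomp Require Import complex.
From mathcomp Require Import reals.
From mathcomp Require Import polyrcf.
From mathcomp Require boolp.
From mathcomp Require Import ring lra zify.

Import Order.TTheory GRing.Theory Num.Theory.
Local Open Scope ring_scope.

(** * Congruences of truncated series and the l1 norm *)

(** The arithmetic enters only through sigma(k) >= k and sum_(k <= K) sigma(k) <= K^2. With r^L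
    about 1/2 they give V of exact order L^3 and W''(1) = O(L^4), so the third-order term is
    O(L^(-1/2)) relative to V^(3/2). The obstacle is to bound differences, which involve
    cancellation. A factor exp(c (X^L + ...)) may be split off as long as W minus its logarithmic
    derivative keeps nonnegative coefficients: the cofactor is then nonnegative too, and its l1 norm
    is its value at 1. Of the m + 1 factors, m absorb (1 - X)^m and one pays for passing from a
    coefficient to the l1 norm; this surplus V^(-1/2) is what the lower bound on a_n' loses. *)

Section TruncatedPolynomials.
Context {R : comNzRingType}.
Implicit Types p q : {poly R}.

Definition eqXn (N : nat) p q := forall i, (i <= N)%N -> p`_i = q`_i.

Definition theta p := 'X * p^`().

Lemma coef_theta p i : (theta p)`_i = i%:R * p`_i.
Proof.
rewrite /theta coefXM; case: i => [|i] /=; first by rewrite mul0r.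
by rewrite coef_deriv mulr_natl.
Qed.

Lemma thetaD p q : theta (p + q) = theta p + theta q.
Proof. by rewrite /theta derivD mulrDr. Qed.

Lemma thetaZ c p : theta (c *: p) = c *: theta p.
Proof. by rewrite /theta derivZ scalerAr. Qed.

Lemma thetaM p q : theta (p * q) = theta p * q + p * theta q.
Proof. by rewrite /theta derivM; ring. Qed.

Lemma theta_exp p n : theta (p ^+ n.+1) = (p ^+ n * theta p) *+ n.+1.
Proof. by rewrite /theta deriv_exp /= -mulrnAr mulrCA -mulr_natr; ring. Qed.

Lemma horner1 p : p.[1] = \sum_(i < size p) p`_i.
Proof. by rewrite horner_coef; apply: eq_bigr => i _; rewrite expr1n mulr1. Qed.

Lemma theta_horner1 p : (theta p).[1] = p^`().[1].
Proof. by rewrite hornerM hornerX mul1r. Qed.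

Lemma eqXn_sym N p q : eqXn N p q -> eqXn N q p.
Proof. by move=> e i le_iN; rewrite e. Qed.

Lemma eqXn_trans N p q r : eqXn N p q -> eqXn N q r -> eqXn N p r.
Proof. by move=> e1 e2 i le_iN; rewrite e1 ?e2. Qed.

Lemma eqXnD N p p' q q' : eqXn N p p' -> eqXn N q q' -> eqXn N (p + q) (p' + q').
Proof. by move=> e1 e2 i le_iN; rewrite !coefD e1 ?e2. Qed.

Lemma eqXnM N p p' q q' : eqXn N p p' -> eqXn N q q' -> eqXn N (p * q) (p' * q').
Proof.
move=> e1 e2 i le_iN; rewrite !coefM; apply: eq_bigr => j _.
by have := ltn_ord j => lt_ji; rewrite e1 ?e2 //; lia.
Qed.

End TruncatedPolynomials.

Section SumNorm.
Context {R : numDomainType}.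
Implicit Types p q : {poly R}.

Definition norm1 p := \sum_(i < size p) `|p`_i|.

Lemma norm1E n p : (size p <= n)%N -> norm1 p = \sum_(i < n) `|p`_i|.
Proof.
move=> le_pn; rewrite /norm1 (big_ord_widen n (fun i => `|p`_i|)) //.
rewrite [RHS](bigID (fun i : 'I_n => (i < size p)%N)) /=.
rewrite [X in _ = _ + X]big1 ?addr0 // => i.
by rewrite -leqNgt => le_pi; rewrite nth_default ?normr0.
Qed.

Lemma norm1_ge0 p : 0 <= norm1 p.
Proof. exact: sumr_ge0. Qed.

Lemma norm1_0 : norm1 0 = 0.
Proof. by rewrite /norm1 size_poly0 big_ord0. Qed.

Lemma norm1D p q : norm1 (p + q) <= norm1 p + norm1 q.
Proof.
rewrite (norm1E (maxn (size p) (size q))) ?size_polyD //.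
rewrite (norm1E (maxn (size p) (size q)) p) ?leq_maxl //.
rewrite (norm1E (maxn (size p) (size q)) q) ?leq_maxr //.
by rewrite -big_split /=; apply: ler_sum => i _; rewrite coefD ler_normD.
Qed.

Lemma norm1_sum (I : Type) (r : seq I) (P : pred I) (F : I -> {poly R}) :
  norm1 (\sum_(i <- r | P i) F i) <= \sum_(i <- r | P i) norm1 (F i).
Proof.
elim/big_ind2: _ => [||//]; first by rewrite norm1_0.
by move=> p a q b hp hq; apply: le_trans (norm1D _ _) _; apply: lerD.
Qed.

Lemma norm1Z c p : norm1 (c *: p) = `|c| * norm1 p.
Proof.
rewrite (norm1E (size p)) ?size_scale_leq // mulr_sumr.
by apply: eq_bigr => i _; rewrite coefZ normrM.
Qed.

Lemma norm1XnM n p : norm1 ('X^n * p) = norm1 p.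
Proof.
rewrite (norm1E (n + size p)); last first.
  by have [->|p0] := eqVneq p 0; rewrite ?mulr0 ?size_poly0 // mulrC size_mulXn.
rewrite big_split_ord /= big1 ?add0r => [|i _]; last first.
  by rewrite coefXnM ltn_ord normr0.
by apply: eq_bigr => i _; rewrite coefXnM ltnNge leq_addr /= addKn.
Qed.

Lemma norm1M p q : norm1 (p * q) <= norm1 p * norm1 q.
Proof.
rewrite -{1}[p]coefK poly_def mulr_suml.
apply: le_trans (norm1_sum _ _ _ _) _.
rewrite {2}/norm1 mulr_suml; apply: ler_sum => i _.
by rewrite -scalerAl norm1Z norm1XnM.
Qed.

Lemma norm1_exp p n : norm1 (p ^+ n) <= norm1 p ^+ n.
Proof.
elim: n => [|n IHn]; first by rewrite !expr0 /norm1 size_poly1 big_ord1 coef1 normr1.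
rewrite !exprS; apply: le_trans (norm1M _ _) _.
by rewrite ler_wpM2l ?norm1_ge0.
Qed.

Lemma norm1_comp_Xn p n : norm1 (p \Po 'X^n) <= norm1 p.
Proof.
rewrite comp_polyE; apply: le_trans (norm1_sum _ _ _ _) _; apply: ler_sum => i _.
rewrite /= norm1Z -[X in _ <= X]mulr1 ler_wpM2l // -exprM -[X in norm1 X]mulr1 norm1XnM.
by rewrite /norm1 size_poly1 big_ord1 coef1 normr1.
Qed.

Definition nneg p := forall i, 0 <= p`_i.

Lemma nneg0 : nneg 0.
Proof. by move=> i; rewrite coef0. Qed.

Lemma nnegXn n : nneg 'X^n.
Proof. by move=> i; rewrite coefXn ler0n. Qed.

Lemma nneg1 : nneg 1.
Proof. by move=> i; rewrite coef1 ler0n. Qed.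

Lemma nnegD p q : nneg p -> nneg q -> nneg (p + q).
Proof. by move=> hp hq i; rewrite coefD addr_ge0. Qed.

Lemma nnegM p q : nneg p -> nneg q -> nneg (p * q).
Proof. by move=> hp hq i; rewrite coefM sumr_ge0 // => j _; rewrite mulr_ge0. Qed.

Lemma nnegZ c p : 0 <= c -> nneg p -> nneg (c *: p).
Proof. by move=> hc hp i; rewrite coefZ mulr_ge0. Qed.

Lemma nneg_exp p n : nneg p -> nneg (p ^+ n).
Proof.
by move=> hp; elim: n => [|n IHn]; [exact: nneg1 | rewrite exprS; exact: nnegM].
Qed.

Lemma nneg_sum (I : Type) (r : seq I) (P : pred I) (F : I -> {poly R}) :
  (forall i, P i -> nneg (F i)) -> nneg (\sum_(i <- r | P i) F i).
Proof.
move=> hF; elim/big_ind: _ => //; [exact: nneg0 | exact: nnegD].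
Qed.

Lemma nneg_theta p : nneg p -> nneg (theta p).
Proof. by move=> hp i; rewrite coef_theta mulr_ge0 ?ler0n. Qed.

Lemma nneg_deriv p : nneg p -> nneg p^`().
Proof. by move=> hp i; rewrite coef_deriv mulrn_wge0. Qed.

Lemma norm1_nneg p : nneg p -> norm1 p = p.[1].
Proof. by move=> hp; rewrite horner1; apply: eq_bigr => i _; rewrite ger0_norm. Qed.

Lemma horner1_ge0 p : nneg p -> 0 <= p.[1].
Proof. by move=> /norm1_nneg <-; exact: norm1_ge0. Qed.

Lemma ler_horner1 p q : (forall i, p`_i <= q`_i) -> p.[1] <= q.[1].
Proof.
move=> le_pq; rewrite -subr_ge0 -hornerN -hornerD; apply: horner1_ge0.
by move=> i; rewrite coefD coefN subr_ge0.
Qed.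

(* The difference [1 - X] turns the sup norm into the l1 norm. *)
Lemma ler_coef_norm1B p i : `|p`_i| <= norm1 ((1 - 'X) * p).
Proof.
have -> : p`_i = \sum_(j < i.+1) ((1 - 'X) * p)`_j.
  elim: i => [|i IHi].
    by rewrite big_ord1 mulrBl mul1r coefB coefXM subr0.
  by rewrite big_ord_recr /= -IHi mulrBl mul1r coefB coefXM /=; ring.
apply: le_trans (ler_norm_sum _ _ _) _.
set q := (1 - 'X) * p; rewrite (norm1E (i.+1 + size q)) ?leq_addl //.
by rewrite big_split_ord /= lerDl sumr_ge0.
Qed.

Lemma norm1_le p q : (forall i, `|p`_i| <= q`_i) -> norm1 p <= q.[1].
Proof.
move=> le_pq.
have -> : norm1 p = (\poly_(i < size p) `|p`_i|).[1].
  by rewrite horner_poly; apply: eq_bigr => i _; rewrite expr1n mulr1.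
apply: ler_horner1 => i; rewrite coef_poly; case: ifP => // _.
exact: le_trans (le_pq i).
Qed.

End SumNorm.

(** * The recurrence for the coefficients of the Euler product *)

Section EulerProduct.
Context {R : realType}.
Implicit Types (alpha : R) (f g : nat -> R).

Definition sigma (n : nat) : nat := \sum_(1 <= k < n.+1 | (k %| n)%N) k.

Definition fps_trunc (N : nat) f : {poly R} := \poly_(i < N.+1) f i.

Lemma coef_fps_trunc N f i : (i <= N)%N -> (fps_trunc N f)`_i = f i.
Proof. by rewrite -ltnS coef_poly => ->. Qed.

Lemma fps_truncM N f g :
  eqXn N (fps_trunc N (fps_mul f g)) (fps_trunc N f * fps_trunc N g).
Proof.
move=> i le_iN; rewrite coef_fps_trunc // coefM; apply: eq_bigr => j _.
by have := ltn_ord j => lt_ji; rewrite !coef_fps_trunc //; lia.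
Qed.

Lemma gbinomialS (a : R) j : j.+1%:R * gbinomial a j.+1 = (a - j%:R) * gbinomial a j.
Proof.
rewrite /gbinomial big_ord_recr /= factS natrM.
have h1 : j.+1%:R != 0 :> R by rewrite pnatr_eq0.
have h2 : j`!%:R != 0 :> R by rewrite pnatr_eq0 -lt0n fact_gt0.
move: j.+1%:R j`!%:R h1 h2 => u v h1 h2.
by field; rewrite h2 h1.
Qed.

Lemma one_sub_Xn_pow_theta N k alpha : (0 < k)%N ->
  let b := fps_trunc N (one_sub_Xn_pow k (- alpha)) in
  eqXn N ((1 - 'X^k) * theta b) ((alpha * k%:R) *: 'X^k * b).
Proof.
move=> k_gt0 b m le_mN; rewrite mulrBl mul1r coefB coefXnM -scalerAl coefZ coefXnM.
rewrite !coef_theta /b; case: ltnP => [lt_mk|le_km].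
  rewrite subr0 mulr0 coef_fps_trunc // /one_sub_Xn_pow.
  have [->|m_gt0] := posnP m; first by rewrite mul0r.
  by rewrite gtnNdvd // mulr0.
rewrite !coef_fps_trunc //; last by lia.
rewrite /one_sub_Xn_pow dvdn_subl //; case: ifP => [/dvdnP[j def_m]|_]; last first.
  by rewrite !mulr0 subr0.
case: j => [|j] in def_m *; first by move: le_km; rewrite def_m mul0n leqNgt k_gt0.
have -> : (m - k = j * k)%N by rewrite def_m mulSn addKn.
rewrite def_m !mulnK // exprS !natrM.
have := gbinomialS (- alpha) j; set x := gbinomial _ j.+1; set y := gbinomial _ j => e.
rewrite [LHS](_ : _ = - (-1) ^+ j * k%:R * (j.+1%:R * x + j%:R * y)); last by ring.
by rewrite e; ring.
Qed.

(** The sum over k <= K of alpha k X^k / (1 - X^k), with each 1 / (1 - X^k) cut to a geometric sum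
    that is exact up to degree N. *)
Definition log_deriv (N K : nat) alpha : {poly R} :=
  \sum_(k < K) (alpha * k.+1%:R) *: 'X^(k.+1) * \sum_(i < N.+1) ('X^(k.+1)) ^+ i.

Lemma euler_partial_prod_theta N K alpha :
  let e := fps_trunc N (euler_partial_prod alpha K) in
  eqXn N (theta e) (log_deriv N K alpha * e).
Proof.
elim: K => [|K IHK] /=.
  move=> i le_iN; rewrite /log_deriv big_ord0 mul0r coef0 coef_theta.
  by rewrite coef_fps_trunc // /fps_one; case: i le_iN => [|i] _; rewrite ?mul0r ?mulr0.
set f := fps_trunc N (euler_partial_prod alpha K) in IHK *.
set b := fps_trunc N (one_sub_Xn_pow K.+1 (- alpha)).
set G : {poly R} := \sum_(i < N.+1) ('X^(K.+1)) ^+ i.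
have theta_b : eqXn N (theta b) ((alpha * K.+1%:R) *: 'X^(K.+1) * G * b).
  (* The product telescopes to 1 - X^((K+1)(N+1)), whose second term lies beyond degree N. *)
  have G_inv : eqXn N (G * (1 - 'X^(K.+1))) 1.
    have -> : G * (1 - 'X^(K.+1)) = 1 - 'X^(K.+1 * N.+1).
      by rewrite exprM -[RHS]opprB subrX1 /G; ring.
    move=> i le_iN; rewrite coefB coefXn; have -> : (i == (K.+1 * N.+1)%N) = false by lia.
    by rewrite subr0.
  apply: eqXn_trans (_ : eqXn N _ (G * (1 - 'X^(K.+1)) * theta b)) _.
    by apply: eqXn_sym; rewrite -[X in eqXn N _ X]mul1r; apply: eqXnM.
  have -> : (alpha * K.+1%:R) *: 'X^(K.+1) * G * b =
            G * ((alpha * K.+1%:R) *: 'X^(K.+1) * b) by ring.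
  by rewrite -mulrA; apply: eqXnM => //; apply: one_sub_Xn_pow_theta.
have eq_fb := fps_truncM N (euler_partial_prod alpha K) (one_sub_Xn_pow K.+1 (- alpha)).
rewrite -/f -/b in eq_fb.
apply: (@eqXn_trans _ _ _ (theta (f * b))).
  by move=> i le_iN; rewrite !coef_theta eq_fb.
apply: eqXn_trans (_ : eqXn N _ (log_deriv N K.+1 alpha * (f * b))) _; last first.
  by apply: eqXnM => //; apply: eqXn_sym.
rewrite thetaM /log_deriv big_ord_recr /= -/(log_deriv N K alpha) -/G mulrDl.
by apply: eqXnD; [rewrite mulrA | rewrite [_ * (f * b)]mulrCA]; apply: eqXnM.
Qed.

Lemma coef_geometric N k m : (0 < k)%N -> (m <= N)%N ->
  (\sum_(i < N.+1) ('X^k) ^+ i : {poly R})`_m = (k %| m)%:R.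
Proof.
move=> k_gt0 le_mN; rewrite coef_sum; case: dvdnP => [[j def_m]|ndvd]; last first.
  rewrite big1 // => i _; rewrite -exprM coefXn; case: eqP => // def_m.
  by case: ndvd; exists i; rewrite def_m mulnC.
have lt_jN : (j < N.+1)%N by rewrite ltnS (leq_trans _ le_mN) // def_m leq_pmulr.
rewrite (bigD1 (Ordinal lt_jN)) //= -exprM coefXn def_m mulnC eqxx big1 ?addr0 //.
move=> i ne_ij; rewrite -exprM coefXn eqn_pmul2l //.
by case: eqP => // eq_ji; case/eqP: ne_ij; apply: val_inj.
Qed.

Lemma coef_log_deriv N K alpha m : (m <= N)%N -> (m <= K)%N ->
  (log_deriv N K alpha)`_m = alpha * (sigma m)%:R.
Proof.
move=> le_mN le_mK; rewrite /log_deriv coef_sum /sigma natr_sum mulr_sumr.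
pose F k := if ((k < m) && (k.+1 %| m))%N then alpha * k.+1%:R else 0.
rewrite (eq_bigr (fun k : 'I_K => F k)) => [|k _]; last first.
  rewrite /F -scalerAl coefZ coefXnM ltnS leqNgt; case: ltnP => //= lt_km; last by rewrite mulr0.
  rewrite coef_geometric //; last by lia.
  by rewrite dvdn_subl //; case: ifP; rewrite ?mulr1 ?mulr0.
rewrite -(big_mkord xpredT F) big_add1 /= (big_cat_nat (leq0n m) le_mK) /=.
rewrite [X in _ + X]big_nat_cond [X in _ + X]big1 ?addr0 => [|k]; last first.
  by rewrite andbT /F => /andP[le_mk _]; rewrite ltnNge le_mk.
rewrite [RHS]big_mkcond; apply: eq_big_nat => k /andP[_ lt_km].
by rewrite /F lt_km.
Qed.

Lemma palpha0 alpha : palpha alpha 0 = 1.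
Proof. by []. Qed.

Lemma palpha_rec alpha n :
  n%:R * palpha alpha n =
  \sum_(k < n.+1) alpha * (sigma k)%:R * palpha alpha (n - k)%N.
Proof.
have := @euler_partial_prod_theta n n alpha n (leqnn n).
rewrite coef_theta coef_fps_trunc // -/(palpha alpha n) => ->.
rewrite coefM; apply: eq_bigr => k _; have le_kn : (k <= n)%N by rewrite -ltnS.
rewrite coef_log_deriv // coef_fps_trunc ?leq_subr //.
by rewrite euler_partial_prod_stable ?leq_subr.
Qed.

Lemma sigma0 : sigma 0 = 0%N.
Proof. by rewrite /sigma big_geq. Qed.

Lemma sigma_ge k : (k <= sigma k)%N.
Proof.
case: k => [//|k]; rewrite /sigma big_mkcond big_nat_recr //= dvdnn.
exact: leq_addl.
Qed.

Lemma palpha_ge0 alpha n : 0 <= alpha -> 0 <= palpha alpha n.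
Proof.
move=> alpha_ge0; elim/ltn_ind: n => -[_|n IHn]; first by rewrite palpha0.
have n_gt0 : 0 < n.+1%:R :> R by rewrite ltr0n.
rewrite -(pmulr_rge0 _ n_gt0) palpha_rec big_ord_recl sigma0 mulr0 mul0r add0r.
apply: sumr_ge0 => i _; rewrite !mulr_ge0 ?ler0n // IHn //.
by rewrite lift0 subSS ltnS leq_subr.
Qed.

(** Exchanging sums gives the terms d * floor(K / d), each at most K. Averaging avoids the
    logarithmic loss of a pointwise bound on sigma. *)
Lemma sum_sigma_le K : (\sum_(k < K.+1) sigma k <= K ^ 2)%N.
Proof.
have -> : (\sum_(k < K.+1) sigma k = \sum_(1 <= d < K.+1) d * (K %/ d))%N.
  elim: K => [|K IHK]; first by rewrite big_ord1 sigma0 big_geq.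
  rewrite big_ord_recr IHK /= [RHS]big_nat_recr //= /sigma.
  have -> : (\sum_(1 <= i < K.+1) i * (K.+1 %/ i) =
             \sum_(1 <= i < K.+1) i * (K %/ i) +
             \sum_(1 <= i < K.+1 | (i %| K.+1)%N) i)%N.
    rewrite [X in _ = _ + X]big_mkcond -big_split; apply: eq_big_nat => i /andP[i_gt0 _] /=.
    by rewrite divnS // mulnDr addnC; case: (i %| K.+1)%N; rewrite ?muln1 ?muln0.
  rewrite divnn /= muln1 -addnA; congr addn.
  by rewrite big_mkcond big_nat_recr //= dvdnn -big_mkcond.
rewrite expnS expn1 -{3}(subn0 K) -subSS -sum_nat_const_nat; apply: leq_sum => d _.
by rewrite mulnC leq_divM.
Qed.

End EulerProduct.
(** * Smoothness of compound Poisson factors *)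

Section Smoothing.
Context {R : realFieldType}.
Implicit Types t c : R.

(** The weight tau stays free because its optimal value would be a square root. *)
Lemma ler_norm_mean (x tau : R) :
  0 < tau -> `|x| <= 2^-1 * (tau + tau^-1 * x ^+ 2).
Proof.
move=> tau_gt0; rewrite -(ler_pM2l tau_gt0) -real_normK ?num_real //.
rewrite [leRHS](_ : _ = 2^-1 * (tau ^+ 2 + `|x| ^+ 2)); last first.
  by field; rewrite lt0r_neq0.
have := sqr_ge0 (tau - `|x|); nra.
Qed.

(* Up to the factor [J + 1], the i-th coefficient of [(1 - X) (1 + X)^J] is
   [C(J + 1, i) (J + 1 - 2 i)], so that the l1 norm is a mean absolute deviation
   of a binomial law, which its variance controls. *)
Lemma norm1_diff_binomial (J : nat) t : (0 < J)%N -> 0 < t ->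
  norm1 ((1 - 'X) * (1 + 'X) ^+ J : {poly R}) <= 2 ^+ J * (t + (t * J.+1%:R)^-1).
Proof.
case: J => // K _ t_gt0; set n : R := K.+2%:R.
have n_gt0 : 0 < n by rewrite ltr0n.
pose P : {poly R} := (1 + 'X) ^+ K.+2.
have P_ge0 i : 0 <= P`_i.
  by apply: nneg_exp; apply: nnegD; [exact: nneg1 | exact: (nnegXn 1)].
have thetaP : theta P = n *: ('X * (1 + 'X) ^+ K.+1).
  by rewrite /theta /P deriv_exp derivD derivX derivC add0r mul1r /=
    -mulr_natl scalerAr -mul_polyC /n polyC_natr.
(* q has the coefficients C(n, i) (n - 2 i)^2, and q(1) = n 2^n is the binomial variance up to
   normalization. *)
pose q := n ^+ 2 *: P - (4 * n) *: theta P + 4 *: theta (theta P).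
have q1 : q.[1] = n * 2 ^+ K.+2.
  rewrite /q thetaP !hornerD hornerN !hornerZ theta_horner1 /P.
  rewrite derivZ derivM derivX !deriv_exp derivD derivX derivC add0r !mul1r -[K.+1.-1]/K.
  rewrite !(hornerMn, hornerD, hornerM, hornerZ, horner_exp, hornerX, hornerC).
  have -> : (1 + 1 : R) = 2 by [].
  rewrite -[2 ^+ K *+ _]mulr_natr (_ : K.+1%:R = n - 1); last by rewrite /n -(natr1 K.+1) addrK.
  rewrite !exprS.
  ring.
have qE i : q`_i = P`_i * (n - 2 * i%:R) ^+ 2.
  by rewrite /q !coefD coefN !coefZ !coef_theta; ring.
have e : n *: ((1 - 'X) * (1 + 'X) ^+ K.+1) = n *: P - 2 *: theta P.
  by rewrite thetaP /P -!mul_polyC !exprS; ring.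
move: q q1 qE => q q1 qE; have tau_gt0 : 0 < t * n by rewrite mulr_gt0.
have : norm1 (n *: ((1 - 'X) * (1 + 'X) ^+ K.+1 : {poly R})) <=
       (2^-1 *: ((t * n) *: P + (t * n)^-1 *: q)).[1].
  apply: norm1_le => i; rewrite e !(coefD, coefN, coefZ) coef_theta qE.
  set x := n - 2 * i%:R.
  rewrite (_ : _ - _ = P`_i * x); last by rewrite /x; ring.
  rewrite normrM ger0_norm //.
  apply: le_trans (ler_wpM2l (P_ge0 i) (ler_norm_mean x _ tau_gt0)) _.
  by rewrite le_eqVlt; apply/orP; left; apply/eqP; ring.
rewrite norm1Z gtr0_norm // hornerZ hornerD !hornerZ q1 /P.
rewrite horner_exp hornerD hornerX hornerC (_ : (1 + 1 : R) = 2) // => h.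
rewrite -(ler_pM2l n_gt0); apply: le_trans h _.
rewrite le_eqVlt; apply/orP; left; apply/eqP.
rewrite -/n !exprS; clear -t_gt0 n_gt0; move: n n_gt0 => u u_gt0; field.
by rewrite !lt0r_neq0.
Qed.

(* [X^L + ... + X^(3 L - 1)], factored so that [1 - X] can be traded for
   [(1 - X^L) (1 + X^L)^J] in its J-th power. *)
Definition hat (L : nat) : {poly R} := 'X^L * (1 + 'X^L) * \sum_(i < L) 'X^i.

Lemma geometric_nneg (L : nat) : nneg (\sum_(i < L) 'X^i : {poly R}).
Proof. by apply: nneg_sum => i _; exact: nnegXn. Qed.

Lemma hat_nneg L : nneg (hat L).
Proof.
apply: nnegM (geometric_nneg L); apply: nnegM (nnegXn L) _.
by apply: nnegD (nnegXn L); exact: nneg1.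
Qed.

Lemma geometric1 (L : nat) : (\sum_(i < L) 'X^i : {poly R}).[1] = L%:R.
Proof.
rewrite horner_sum (eq_bigr (fun=> 1)) => [|i _]; last by rewrite hornerXn expr1n.
by rewrite sumr_const card_ord.
Qed.

Lemma hat1 L : (hat L).[1] = 2 * L%:R.
Proof. by rewrite !hornerM hornerD geometric1 !hornerXn hornerC expr1n mul1r. Qed.

Lemma norm1_diff_hat_exp L J t : 0 < t ->
  norm1 ((1 - 'X) * hat L ^+ J.+1) <=
  2 ^+ J.+1 * (t + (t * J.+2%:R)^-1) * L%:R ^+ J.
Proof.
move=> t_gt0; set H : {poly R} := \sum_(i < L) 'X^i.
have -> : (1 - 'X) * hat L ^+ J.+1 =
  'X^(L * J.+1) * ((((1 - 'X) * (1 + 'X) ^+ J.+1) \Po 'X^L) * H ^+ J).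
  rewrite rmorphM rmorphXn /= comp_polyB comp_polyD comp_polyX comp_polyC.
  have -> : 1%:P - 'X^L = (1 - 'X) * H :> {poly R}.
    by rewrite -[LHS]opprB subrX1 /H; ring.
  by rewrite exprM /hat -/H !exprMn [H ^+ J.+1]exprS; ring.
rewrite norm1XnM; apply: le_trans (norm1M _ _) _; apply: ler_pM; rewrite ?norm1_ge0 //.
  by apply: le_trans (norm1_comp_Xn _ _) _; exact: norm1_diff_binomial.
apply: le_trans (norm1_exp _ _) _.
by rewrite (norm1_nneg _ (geometric_nneg L)) geometric1.
Qed.

Definition exp_trunc (N : nat) (x : R) := \sum_(J < N.+1) x ^+ J / J`!%:R.

(** The compound Poisson factor exp(c hat L). Cutting the exponential series rather than the degree
    keeps it a combination of powers of [hat L], to which [norm1_diff_hat_exp] applies. *)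
Definition hat_exp (N L : nat) c : {poly R} :=
  \sum_(J < N.+1) (c ^+ J / J`!%:R) *: hat L ^+ J.

Lemma hat_exp_nneg N L c : 0 <= c -> nneg (hat_exp N L c).
Proof.
move=> c_ge0; apply: nneg_sum => J _.
by apply: nnegZ; [rewrite divr_ge0 ?exprn_ge0 | exact/nneg_exp/hat_nneg].
Qed.

Lemma hat_exp1 N L c : (hat_exp N L c).[1] = exp_trunc N (c * (2 * L%:R)).
Proof.
rewrite horner_sum; apply: eq_bigr => J _.
by rewrite hornerZ horner_exp hat1 [in RHS]exprMn [RHS]mulrAC.
Qed.

(** The binomial estimate is averaged over a Poisson variable J of mean lam, with the same t for all
    J: the factor 1 / (J + 1) merely shifts the weight of J to that of J + 1, divided by lam. *)
Lemma norm1_diff_hat_exp_trunc N L c t (lam := c * (2 * L%:R)) :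
  0 < c -> 0 < t -> (0 < L)%N -> (1 < N)%N -> lam <= N.+1%:R ->
  norm1 ((1 - 'X) * hat_exp N L c) <=
  (4 / lam ^+ 2 + (t + 2 / (t * lam)) / L%:R) * exp_trunc N lam.
Proof.
move=> c_gt0 t_gt0 L_gt0 N_gt1 le_lamN.
have l_gt0 : 0 < L%:R :> R by rewrite ltr0n.
have lam_gt0 : 0 < lam by rewrite !mulr_gt0.
have fact_gt0R k : 0 < k`!%:R :> R by rewrite ltr0n fact_gt0.
have term_ge0 k : 0 <= lam ^+ k / k`!%:R by rewrite divr_ge0 ?exprn_ge0 ?ltW.
set e := exp_trunc N lam.
(* One term lies beyond the truncation; lam <= N + 1 makes it at most its predecessor, whence the
   factor 2. *)
have e_shift : \sum_(J < N) lam ^+ J.+2 / J.+2`!%:R <= 2 * e.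
  have -> : \sum_(J < N) lam ^+ J.+2 / J.+2`!%:R =
            exp_trunc N.+1 lam - 1 - lam.
    rewrite /exp_trunc !big_ord_recl /= /bump /= fact0 expr0 expr1 !divr1.
    by rewrite (eq_bigr (fun J : 'I_N => lam ^+ J.+2 / J.+2`!%:R)) //; ring.
  have -> : exp_trunc N.+1 lam = e + lam ^+ N.+1 / N.+1`!%:R.
    by rewrite /exp_trunc big_ord_recr.
  have : lam ^+ N.+1 / N.+1`!%:R <= e.
    apply: le_trans (_ : lam ^+ N / N`!%:R <= _).
      rewrite exprS factS natrM invfM mulrACA -[X in _ <= X]mul1r ler_wpM2r //.
      by rewrite ler_pdivrMr ?mul1r ?ltr0n.
    by rewrite /e /exp_trunc big_ord_recr /= lerDr sumr_ge0.
  lra.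
have e_ge2 : lam ^+ 2 / 2 <= e.
  rewrite /e /exp_trunc (bigD1 (Ordinal (N_gt1 : (2 < N.+1)%N))) //=.
  by rewrite lerDl sumr_ge0.
have e_tail : \sum_(J < N) lam ^+ J.+1 / J.+1`!%:R <= e.
  by rewrite /e /exp_trunc big_ord_recl /= lerDr divr_ge0 ?ler01.
(* The term J = 0 is not smoothed; its norm 2 is absorbed by 4 / lam^2, as e >= lam^2 / 2. *)
rewrite /hat_exp big_ord_recl expr0 fact0 divr1 scale1r mulrDr mulr1.
apply: le_trans (norm1D _ _) _; rewrite [leRHS]mulrDl; apply: lerD.
  have -> : norm1 (1 - 'X : {poly R}) = 2.
    rewrite (@norm1E _ 2) ?big_ord_recr ?big_ord0 /=; last first.
      by rewrite -opprB size_polyN size_XsubC.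
    by rewrite !coefB !coef1 !coefX /= subr0 sub0r normrN normr1; ring.
  rewrite mulrAC ler_pdivlMr ?exprn_gt0 //; lra.
rewrite mulr_sumr; apply: le_trans (norm1_sum _ _ _ _) _.
apply: (@le_trans _ _ (\sum_(J < N) (t / L%:R * (lam ^+ J.+1 / J.+1`!%:R) +
    (t * lam * L%:R)^-1 * (lam ^+ J.+2 / J.+2`!%:R)))).
  apply: ler_sum => J _; rewrite -scalerAr norm1Z /= /bump /= add1n.
  rewrite ger0_norm; last by rewrite divr_ge0 ?exprn_ge0 ?ltW.
  apply: le_trans (ler_wpM2l _ (norm1_diff_hat_exp _ _ _ t_gt0)) _.
    by rewrite divr_ge0 ?exprn_ge0 ?ltW.
  rewrite le_eqVlt; apply/orP; left; apply/eqP.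
  rewrite (factS J.+1) natrM.
  have := fact_gt0R J.+1; have : 0 < J.+2%:R :> R by rewrite ltr0n.
  move: J.+1`!%:R J.+2%:R => u v u_gt0 v_gt0.
  rewrite !exprS /lam !exprMn; field.
  by rewrite !lt0r_neq0.
rewrite big_split -!mulr_sumr /=.
apply: le_trans (lerD (ler_wpM2l _ e_tail) (ler_wpM2l _ e_shift)) _.
- by rewrite divr_ge0 ?ltW.
- by rewrite invr_ge0 ?mulr_ge0 ?ltW.
rewrite le_eqVlt; apply/orP; left; apply/eqP.
by field; rewrite !lt0r_neq0.
Qed.

End Smoothing.

(** * Splitting a series into smoothing factors and a nonnegative cofactor *)

Section SmoothingEstimate.
Context {R : realFieldType}.
Implicit Types (W A B G H : {poly R}) (c t : R).

(** G is the truncated exponential of the integral of W / X, built coefficient by coefficient, so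
    that nonnegativity is inherited from W. It supplies the cofactor of the smoothing factors. *)
Lemma exists_log_deriv N W : nneg W -> W`_0 = 0 ->
  exists G, [/\ nneg G, (size G <= N.+1)%N, G`_0 = 1 & eqXn N (theta G) (W * G)].
Proof.
move=> W_ge0 W0; elim: N => [|N [G [G_ge0 sG G0 eqG]]].
  exists 1; split; [exact: nneg1 | by rewrite size_poly1 | by rewrite coef1 |].
  by move=> i; rewrite leqn0 => /eqP->; rewrite coef_theta mulr1 W0 mul0r.
pose g := (W * G)`_N.+1 / N.+1%:R.
have g_ge0 : 0 <= g by rewrite divr_ge0 ?ler0n //; exact: nnegM.
have WX i : (i <= N.+1)%N -> (W * (g *: 'X^(N.+1)))`_i = 0.
  move=> le_iN; rewrite -scalerAr coefZ coefMXn; case: ltnP => [_|le_Ni]; first by rewrite mulr0.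
  by rewrite (_ : (i - N.+1 = 0)%N) ?W0 ?mulr0 //; lia.
exists (G + g *: 'X^(N.+1)); split.
- by apply: nnegD => //; apply: nnegZ => //; exact: nnegXn.
- apply: leq_trans (size_polyD _ _) _; rewrite geq_max (leq_trans sG) //=.
  by rewrite (leq_trans (size_scale_leq _ _)) ?size_polyXn.
- by rewrite coefD coefZ coefXn mulr0 addr0.
move=> i le_iN; rewrite mulrDr thetaD !coefD WX // addr0 thetaZ coefZ !coef_theta coefXn.
move: le_iN; rewrite leq_eqVlt => /orP[/eqP ->|lt_iN].
  rewrite eqxx mulr1 (nth_default _ sG) mulr0 add0r /g divfK ?pnatr_eq0 //.
by rewrite (ltn_eqF lt_iN) !mulr0 addr0 -coef_theta eqG.
Qed.

Lemma log_deriv_unique N W A B : W`_0 = 0 -> A`_0 = B`_0 ->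
  eqXn N (theta A) (W * A) -> eqXn N (theta B) (W * B) -> eqXn N A B.
Proof.
move=> W0 AB0 eqA eqB i; elim/ltn_ind: i => -[//|i IHi] le_iN.
have i_neq0 : i.+1%:R != 0 :> R by rewrite pnatr_eq0.
apply: (mulfI i_neq0); rewrite -!coef_theta eqA // eqB // !coefM.
rewrite big_ord_recl [RHS]big_ord_recl W0 !mul0r.
congr (_ + _); apply: eq_bigr => j _; rewrite IHi //.
  by rewrite lift0 subSS ltnS leq_subr.
by rewrite lift0 subSS (leq_trans (leq_subr _ _)) // ltnW.
Qed.

(** The cut exponential misses its differential equation by an explicit term. For L > 0 it has no
    coefficient of degree <= N, and for c >= 0 it is nonnegative: hence the congruence and the
    inequality at 1 below. *)
Lemma theta_hat_exp N L c :
  c *: theta (hat L) * hat_exp N L c =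
  theta (hat_exp N L c) + (c ^+ N.+1 / N`!%:R) *: (theta (hat L) * hat L ^+ N).
Proof.
elim: N => [|N IHN]; rewrite /hat_exp.
  rewrite big_ord1 fact0 !expr0 expr1 !divr1 scale1r !mulr1.
  by rewrite [X in _ = X + _](_ : _ = 0) ?add0r // /theta -polyC1 derivC mulr0.
rewrite big_ord_recr /= mulrDr thetaD -/(hat_exp N L c) IHN -!addrA; congr (_ + _).
rewrite thetaZ theta_exp; congr (_ + _); last first.
  by rewrite -scalerAl -scalerAr scalerA mulrA -exprS.
rewrite -(scaler_nat N.+1 (_ * _)) scalerA (mulrC (theta _)); congr (_ *: _).
rewrite factS natrM; have : N`!%:R != 0 :> R by rewrite pnatr_eq0 -lt0n fact_gt0.
have : N.+1%:R != 0 :> R by rewrite pnatr_eq0.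
by move: N.+1%:R N`!%:R => u v u0 v0; field; rewrite u0 v0.
Qed.

Lemma eqXn_theta_hat_exp N L c : (0 < L)%N ->
  eqXn N (theta (hat_exp N L c)) (c *: theta (hat L) * hat_exp N L c).
Proof.
move=> L_gt0 i le_iN; rewrite theta_hat_exp coefD coefZ.
rewrite [X in _ = _ + _ * X](_ : _ = 0) ?mulr0 ?addr0 //.
rewrite /hat -mulrA exprMn -exprM mulrCA coefXnM.
case: ltnP => // le_LNi.
have -> : (i = L * N)%N by apply/eqP; rewrite eqn_leq le_LNi (leq_trans le_iN) // leq_pmull.
by rewrite subnn coefM big_ord1 coef_theta !mul0r.
Qed.

Lemma coef0_hat_exp N L c : (0 < L)%N -> (hat_exp N L c)`_0 = 1.
Proof.
move=> L_gt0; rewrite /hat_exp big_ord_recl coefD expr0 fact0 divr1 scale1r coef1.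
rewrite coef_sum big1 ?addr0 // => J _; rewrite coefZ /hat -mulrA exprMn -exprM coefXnM.
by rewrite lift0 muln_gt0 L_gt0 mulr0.
Qed.

Lemma theta_hat_exp1_le N L c : 0 <= c ->
  (theta (hat_exp N L c)).[1] <= (c *: theta (hat L)).[1] * (hat_exp N L c).[1].
Proof.
move=> c_ge0; rewrite -[leRHS]hornerM theta_hat_exp hornerD lerDl; apply: horner1_ge0.
apply: nnegZ; first by rewrite divr_ge0 ?exprn_ge0.
by apply: nnegM; [exact/nneg_theta/hat_nneg | exact/nneg_exp/hat_nneg].
Qed.

Lemma Markov_horner1 N W A H : nneg H -> (size A <= N.+1)%N -> eqXn N A H ->
  (theta H).[1] <= W.[1] * H.[1] -> 2 * W.[1] <= N.+1%:R -> H.[1] <= 2 * A.[1].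
Proof.
move=> H_ge0 sA eqAH le_thetaH le_WN.
have : (N.+1%:R *: (H - A)).[1] <= (theta H).[1].
  apply: ler_horner1 => i; rewrite coefZ coefB coef_theta; case: (ltnP N i) => hi.
    by rewrite (nth_default _ (leq_trans sA hi)) subr0 ler_wpM2r // ler_nat.
  by rewrite eqAH // subrr mulr0 mulr_ge0 ?ler0n.
rewrite hornerZ hornerD hornerN.
have := horner1_ge0 _ H_ge0; have : 0 < N.+1%:R :> R by rewrite ltr0n.
move: N.+1%:R le_WN => n le_Wn n_gt0 H1_ge0 h.
rewrite -(ler_pM2l n_gt0); nra.
Qed.

(** Up to degree N, A is E^(m+1) G, where E is [hat_exp N L c] and G has the logarithmic derivative
    W - (m+1) c theta (hat L), nonnegative by assumption. Each E takes one factor 1 - X. *)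
Lemma diff_coef_bound (N L m : nat) W A c t (lam := c * (2 * L%:R)) :
  W`_0 = 0 -> A`_0 = 1 -> (size A <= N.+1)%N -> eqXn N (theta A) (W * A) ->
  0 < c -> 0 < t -> (0 < L)%N -> (1 < N)%N -> lam <= N.+1%:R ->
  2 * W.[1] <= N.+1%:R ->
  (forall i, m.+1%:R * c * (theta (hat L))`_i <= W`_i) ->
  forall j, (j <= N)%N ->
  `|((1 - 'X) ^+ m * A)`_j| <=
  2 * (4 / lam ^+ 2 + (t + 2 / (t * lam)) / L%:R) ^+ m.+1 * A.[1].
Proof.
move=> W0 A0 sA eqA c_gt0 t_gt0 L_gt0 N_gt1 le_lamN le_WN le_hatW j le_jN.
set eps := 4 / _ + _; pose V := c *: theta (hat L); pose WG := W - V *+ m.+1.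
have WG_ge0 : nneg WG.
  by move=> i; rewrite coefB coefMn coefZ subr_ge0 -mulr_natl mulrA.
have WG0 : WG`_0 = 0 by rewrite coefB coefMn coefZ coef_theta W0 mul0r mulr0 mul0rn subr0.
have [G [G_ge0 sG G0 eqG]] := @exists_log_deriv N WG WG_ge0 WG0.
pose E := hat_exp N L c; pose H := E ^+ m.+1 * G.
have E_ge0 : nneg E by apply: hat_exp_nneg; exact: ltW.
have H_ge0 : nneg H by apply: nnegM => //; exact: nneg_exp.
have thetaH : theta H = (E ^+ m * theta E) *+ m.+1 * G + E ^+ m.+1 * theta G.
  by rewrite thetaM theta_exp.
have eqH : eqXn N (theta H) (W * H).
  rewrite thetaH; have -> : W * H = (E ^+ m * (V * E)) *+ m.+1 * G + E ^+ m.+1 * (WG * G).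
    rewrite /H /WG (mulrCA (E ^+ m)) -mulrnAl exprS.
    by move: (V *+ _) (E ^+ m) => v e; ring.
  apply: eqXnD; last exact: eqXnM.
  apply: eqXnM => // i le_iN; rewrite !coefMn; congr (_ *+ _).
  move: i le_iN; apply: eqXnM => //; exact: eqXn_theta_hat_exp.
have H0 : H`_0 = 1.
  rewrite coefM big_ord1 G0 mulr1; elim: (m.+1) => [|k IHk]; first by rewrite coef1.
  by rewrite exprS coefM big_ord1 coef0_hat_exp // mul1r.
have eqAH : eqXn N A H by apply: (log_deriv_unique N W) => //; rewrite A0 H0.
have H1 : H.[1] = E.[1] ^+ m.+1 * G.[1] by rewrite hornerM horner_exp.
have G1_ge0 := horner1_ge0 _ G_ge0; have E1_ge0 := horner1_ge0 _ E_ge0.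
have thetaG1 : (theta G).[1] <= WG.[1] * G.[1].
  rewrite -hornerM; apply: ler_horner1 => i; case: (leqP i N) => hi; first by rewrite eqG.
  by rewrite coef_theta (nth_default _ (leq_trans sG hi)) mulr0; apply: nnegM.
have H1_le : H.[1] <= 2 * A.[1].
  apply: (Markov_horner1 N W) => //.
  have -> : (theta H).[1] = (E.[1] ^+ m * (theta E).[1]) *+ m.+1 * G.[1] +
                            E.[1] ^+ m.+1 * (theta G).[1].
    rewrite thetaH hornerD (hornerM (_ *+ _)) hornerMn.
    by rewrite (hornerM (E ^+ m)) (hornerM (E ^+ m.+1)) !horner_exp.
  have -> : W.[1] = V.[1] *+ m.+1 + WG.[1] by rewrite hornerD hornerN hornerMn; ring.
  have := theta_hat_exp1_le N L _ (ltW c_gt0); rewrite -/E -/V => thetaE1.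
  rewrite H1 mulrDl; apply: lerD; last first.
    by rewrite [leRHS]mulrCA ler_wpM2l ?exprn_ge0.
  rewrite mulrA ler_wpM2r // mulrnAl lerMn2r /= exprS [leRHS]mulrA [leRHS]mulrC.
  by rewrite ler_wpM2l ?exprn_ge0.
have -> : ((1 - 'X) ^+ m * A)`_j = ((1 - 'X) ^+ m * H)`_j.
  exact: (@eqXnM _ N).
(* The additional 1 - X introduced here goes to the (m+1)-st copy of E. *)
apply: le_trans (ler_coef_norm1B _ _) _.
have -> : (1 - 'X) * ((1 - 'X) ^+ m * H) = ((1 - 'X) * E) ^+ m.+1 * G.
  by rewrite /H exprMn mulrA -exprS mulrA.
apply: le_trans (norm1M _ _) _; rewrite (norm1_nneg _ G_ge0).
apply: le_trans (_ : eps ^+ m.+1 * H.[1] <= _); last first.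
  rewrite mulrAC [leRHS]mulrC ler_wpM2l // exprn_ge0 // /eps.
  have lam_gt0 : 0 < lam by rewrite !mulr_gt0 ?ltr0n.
  apply: addr_ge0; first by apply: divr_ge0; [exact: ler0n | exact/exprn_ge0/ltW].
  apply: divr_ge0; last exact: ler0n.
  apply: addr_ge0; first exact: ltW.
  by apply: divr_ge0; [exact: ler0n | exact/ltW/mulr_gt0].
rewrite H1 mulrA -exprMn ler_wpM2r //; apply: le_trans (norm1_exp _ _) _.
have := norm1_diff_hat_exp_trunc N L c t c_gt0 t_gt0 L_gt0 N_gt1 le_lamN.
rewrite -/lam -/eps -/E -hat_exp1 -/E => le_epsE.
by apply: lerXn2r => //; rewrite nnegrE ?norm1_ge0 // (le_trans (norm1_ge0 _) le_epsE).
Qed.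

End SmoothingEstimate.

(** * Differences at the saddle point *)

Section SaddlePoint.
Context {R : realFieldType}.
Implicit Types (W A Q T : {poly R}).

(** The remainder follows Horner's scheme: for p X + c it is p'(1) + X T, with T that of p. So it is
    nonnegative, and its l1 norm is W''(1) / 2. *)
Lemma Taylor2_at1 W : nneg W -> exists T, [/\ nneg T,
  W = W.[1]%:P - W^`().[1] *: (1 - 'X) + T * (1 - 'X) ^+ 2 &
  2 * T.[1] = W^`()^`().[1]].
Proof.
elim/poly_ind: W => [_|p c IHp pX_ge0].
  exists 0; split; first exact: nneg0.
    by rewrite deriv0 !horner0 scale0r subr0 mul0r add0r.
  by rewrite !deriv0 !horner0 mulr0.
have p_ge0 : nneg p by move=> i; have := pX_ge0 i.+1; rewrite coefD coefMX coefC addr0.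
have [T [T_ge0 defp T1]] := IHp p_ge0.
have dp : (p * 'X + c%:P)^`() = p^`() * 'X + p.
  by rewrite derivD derivM derivX derivC mulr1 addr0.
exists (p^`().[1]%:P + 'X * T); split.
- apply: nnegD; last by apply: nnegM => //; exact: (nnegXn 1).
  move=> i; rewrite coefC; case: ifP => // _; exact/horner1_ge0/nneg_deriv.
- rewrite dp !hornerD !hornerM !hornerX hornerC {1}defp -!mul_polyC !rmorphD /= !mulr1; ring.
rewrite dp derivD derivM derivX hornerD hornerM hornerC hornerX.
by rewrite !hornerD !hornerM hornerX -T1 hornerC; ring.
Qed.

Lemma sum_coef_le n Q : nneg Q -> \sum_(i < n) Q`_i <= Q.[1].
Proof.
move=> Q_ge0; rewrite -norm1_nneg // (norm1E (n + size Q)) ?leq_addl //.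
rewrite big_split_ord /= (eq_bigr (fun i : 'I_n => `|Q`_i|)) ?lerDl ?sumr_ge0 // => i _.
by rewrite ger0_norm.
Qed.

Lemma coefM_bound N T Q b : nneg T -> (forall i, (i <= N)%N -> `|Q`_i| <= b) ->
  forall j, (j <= N)%N -> `|(T * Q)`_j| <= T.[1] * b.
Proof.
move=> T_ge0 le_Qb j le_jN; have b_ge0 : 0 <= b := le_trans (normr_ge0 _) (le_Qb j le_jN).
rewrite coefM; apply: le_trans (ler_norm_sum _ _ _) _.
apply: le_trans (ler_wpM2r b_ge0 (sum_coef_le j.+1 _ T_ge0)).
rewrite mulr_suml; apply: ler_sum => i _; rewrite normrM (ger0_norm (T_ge0 _)).
by rewrite ler_wpM2l // le_Qb // (leq_trans (leq_subr _ _)).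
Qed.

Section Recursion.
Variables (N : nat) (W A T : {poly R}) (M V : R).
Hypothesis defW : W = M%:P - V *: (1 - 'X) + T * (1 - 'X) ^+ 2.
Hypothesis eqA : eqXn N (theta A) (W * A).

Let D k j := ((1 - 'X) ^+ k * A)`_j.

Lemma diff_rec1 j : (j <= N)%N ->
  V * D 1 j = (M - j%:R) * A`_j + (T * ((1 - 'X) ^+ 2 * A))`_j.
Proof.
move=> le_jN; have := eqA _ le_jN; rewrite coef_theta.
have -> : W * A = M *: A - V *: ((1 - 'X) ^+ 1 * A) + T * ((1 - 'X) ^+ 2 * A).
  by rewrite defW -!mul_polyC; ring.
rewrite coefD coefB !coefZ -/(D 1 j) => e; lra.
Qed.

(** Coefficient j of (1 - X)^(k+1) theta A = (1 - X)^(k+1) W A. Moving theta outside the product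
    produces D_k - D_(k+1), because theta (1 - X) = (1 - X) - 1. *)
Lemma diff_rec k j : (j <= N)%N ->
  V * D k.+2 j = (M - j%:R) * D k.+1 j - k.+1%:R * (D k j - D k.+1 j) +
                 (T * ((1 - 'X) ^+ k.+3 * A))`_j.
Proof.
move=> le_jN.
have : eqXn N ((1 - 'X) ^+ k.+1 * theta A) ((1 - 'X) ^+ k.+1 * (W * A)) by exact: eqXnM.
move=> /(_ j le_jN).
have -> : (1 - 'X) ^+ k.+1 * theta A =
    theta ((1 - 'X) ^+ k.+1 * A) + k.+1%:R *: ((1 - 'X) ^+ k * A - (1 - 'X) ^+ k.+1 * A).
  rewrite thetaM theta_exp {2}/theta derivB derivX -polyC1 derivC polyC1 sub0r.
  rewrite scaler_nat exprS; set X1 := (1 - 'X) ^+ k.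
  by rewrite mulrN1 mulrN -mulrN mulrnAl addrAC -mulrnDl -[LHS]add0r; congr (_ + _);
    rewrite (_ : _ + _ = 0) ?mul0rn //; ring.
have -> : (1 - 'X) ^+ k.+1 * (W * A) = M *: ((1 - 'X) ^+ k.+1 * A) -
    V *: ((1 - 'X) ^+ k.+2 * A) + T * ((1 - 'X) ^+ k.+3 * A).
  by rewrite defW -!mul_polyC !exprS; ring.
rewrite !(coefD, coefN, coefZ) coef_theta -!/(D _ j) => e; lra.
Qed.

End Recursion.

Lemma deriv1_ge W : nneg W -> W`_0 = 0 -> W.[1] <= W^`().[1].
Proof.
move=> W_ge0 W0; rewrite -theta_horner1; apply: ler_horner1 => -[|i].
  by rewrite coef_theta W0 mul0r.
by rewrite coef_theta -[leLHS]mul1r ler_wpM2r // ler1n.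
Qed.

(** Without truncation the mean would be n and the variance V. The cut lowers the mean; N >= n + n^2
    ensures that n times the deficit n A(1) - (theta A)(1) is at most V A(1), whence the factor
    2. *)
Lemma Chebyshev N n W A : nneg W -> nneg A -> W`_0 = 0 -> (size A <= N.+1)%N ->
  eqXn N (theta A) (W * A) -> W.[1] = n%:R -> (n + n ^ 2 <= N)%N ->
  \sum_(i < N.+1) (i%:R - n%:R) ^+ 2 * A`_i <= 2 * W^`().[1] * A.[1].
Proof.
move=> W_ge0 A_ge0 W0 sA eqA W1 le_nN; set V := W^`().[1].
pose q := theta (theta A) - (2 * n%:R) *: theta A + n%:R ^+ 2 *: A.
have -> : \sum_(i < N.+1) (i%:R - n%:R) ^+ 2 * A`_i = q.[1].
  have sq : (size q <= N.+1)%N.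
    apply/leq_sizeP => i hi; rewrite !(coefD, coefN, coefZ) !coef_theta.
    by rewrite (nth_default _ (leq_trans sA hi)) !mulr0 subr0 addr0.
  rewrite (horner_coef_wide _ sq); apply: eq_bigr => i _; rewrite expr1n mulr1.
  by rewrite !(coefD, coefN, coefZ) !coef_theta; ring.
have WA_ge0 : nneg (W * A) by exact: nnegM.
have le_theta i : (theta A)`_i <= (W * A)`_i.
  case: (leqP i N) => hi; first by rewrite eqA.
  by rewrite coef_theta (nth_default _ (leq_trans sA hi)) mulr0.
have S1_le := ler_horner1 _ _ le_theta; rewrite (hornerM W) W1 in S1_le.
have theta_WA : (theta (W * A)).[1] = V * A.[1] + n%:R * (theta A).[1].
  by rewrite thetaM hornerD (hornerM (theta W)) (hornerM W) (theta_horner1 W) W1.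
have S2_le : (theta (theta A)).[1] <= (theta (W * A)).[1].
  apply: ler_horner1 => i; rewrite coef_theta [leRHS]coef_theta.
  by rewrite ler_wpM2l ?ler0n.
have tail : N.+1%:R * (n%:R * A.[1] - (theta A).[1]) <= (theta (W * A)).[1].
  rewrite -W1 -hornerM -hornerN -hornerD -hornerZ; apply: ler_horner1 => i.
  rewrite coefZ coefB [leRHS]coef_theta; case: (leqP i N) => hi.
    by rewrite eqA // subrr mulr0 mulr_ge0 ?ler0n.
  rewrite coef_theta (nth_default _ (leq_trans sA hi)) mulr0 subr0.
  by rewrite ler_wpM2r // ler_nat.
have S_ge0 := horner1_ge0 _ A_ge0.
have V_ge : n%:R <= V by rewrite -W1; exact: deriv1_ge.
have N_ge : n%:R + n%:R ^+ 2 <= N.+1%:R :> R.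
  by rewrite -natrX -natrD ler_nat (leq_trans le_nN).
have n_ge0 : 0 <= n%:R :> R by exact: ler0n.
have N_gt0 : 0 < N.+1%:R :> R by rewrite ltr0n.
have -> : q.[1] = (theta (theta A)).[1] - 2 * n%:R * (theta A).[1] + n%:R ^+ 2 * A.[1].
  by rewrite /q !hornerD hornerN !hornerZ.
rewrite {}theta_WA in S2_le tail.
move: (theta (theta A)).[1] (theta A).[1] A.[1] (n%:R : R) (N.+1%:R : R) S_ge0 {W1}
  S1_le S2_le tail V_ge N_ge n_ge0 N_gt0
  => s2 s1 s x y s_ge0 s1_le s2_le tail V_ge y_ge x_ge0 y_gt0.
have h1 : y * (x * (x * s - s1)) <= y * (V * s).
  have h2 : y * (x * s - s1) <= (V + x ^+ 2) * s by nra.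
  have h3 := ler_wpM2l x_ge0 h2.
  have h4 : x * (V + x ^+ 2) <= y * V by nra.
  have h5 := ler_wpM2r s_ge0 h4; lra.
rewrite ler_pM2l // in h1; nra.
Qed.

Lemma card_window n K N :
  (#|[pred i : 'I_N | (n <= i + K) && (i <= n + K)]| <= (K + K).+1)%N.
Proof.
rewrite cardE -(size_map (@nat_of_ord N)) -(size_iota (n - K) (K + K).+1); apply: uniq_leq_size.
  by rewrite map_inj_uniq ?enum_uniq //; exact: ord_inj.
move=> x hx; case: (mapP hx) => i; rewrite mem_enum inE => /andP[h1 h2] ->.
by rewrite mem_iota; lia.
Qed.

(* By Chebyshev's inequality the window [|i - n| <= 2 K] carries half of the
   mass, and [diff_rec1] makes the coefficients almost unimodal around [n]. *)
Lemma central_coef_bound N n K W A T b (V := W^`().[1]) :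
  nneg W -> nneg A -> nneg T -> W`_0 = 0 -> (size A <= N.+1)%N ->
  eqXn N (theta A) (W * A) -> W.[1] = n%:R -> (n + n ^ 2 <= N)%N ->
  W = W.[1]%:P - V *: (1 - 'X) + T * (1 - 'X) ^+ 2 -> 0 < V ->
  (forall i, (i <= N)%N -> `|((1 - 'X) ^+ 2 * A)`_i| <= b) ->
  V <= K%:R ^+ 2 ->
  A.[1] <= 2 * (4 * K%:R + 1) * (A`_n + 2 * K%:R * (T.[1] * b / V)).
Proof.
move=> W_ge0 A_ge0 T_ge0 W0 sA eqA W1 le_nN defW V_gt0 le_b le_VK.
set e := T.[1] * b / V.
have b_ge0 : 0 <= b := le_trans (normr_ge0 _) (le_b 0%N (leq0n N)).
have e_ge0 : 0 <= e.
  by apply: divr_ge0; [apply: mulr_ge0 => //; exact: horner1_ge0 | exact: ltW].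
have err j (le_jN : (j <= N)%N) := coefM_bound _ _ _ _ T_ge0 le_b j le_jN.
have D1 j : ((1 - 'X) ^+ 1 * A)`_j.+1 = A`_j.+1 - A`_j.
  by rewrite expr1 mulrBl mul1r coefB coefXM.
have V_e : V * e = T.[1] * b by rewrite /e mulrCA divff ?mulr1 // lt0r_neq0.
(* Beyond n the drift (n - j - 1) A_(j+1) is nonpositive, so a step up is at most the error e;
   [down] is the mirror image. *)
have up j : (n <= j)%N -> (j < N)%N -> A`_j.+1 <= A`_j + e.
  move=> le_nj lt_jN; have := diff_rec1 _ _ _ _ _ _ defW eqA _ lt_jN.
  rewrite W1 D1 => rec; have := err _ lt_jN; rewrite ler_norml => /andP[_ h].
  have : (n%:R - j.+1%:R) * A`_j.+1 <= 0.
    by rewrite mulr_le0_ge0 // subr_le0 ler_nat leqW.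
  move=> h'; rewrite -subr_ge0 -(pmulr_rge0 _ V_gt0); lra.
have down j : (j < n)%N -> A`_j <= A`_j.+1 + e.
  move=> lt_jn; have lt_jN : (j < N)%N by lia.
  have := diff_rec1 _ _ _ _ _ _ defW eqA _ lt_jN.
  rewrite W1 D1 => rec; have := err _ lt_jN; rewrite ler_norml => /andP[h _].
  have : 0 <= (n%:R - j.+1%:R) * A`_j.+1.
    by rewrite mulr_ge0 // subr_ge0 ler_nat.
  move=> h'; rewrite -subr_ge0 -(pmulr_rge0 _ V_gt0); lra.
have up_n k : (n + k <= N)%N -> A`_(n + k) <= A`_n + k%:R * e.
  elim: k => [|k IHk]; first by rewrite addn0 mul0r addr0.
  rewrite addnS => h; have := IHk (ltnW h); have := up _ (leq_addr _ _) h.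
  rewrite -natr1; lra.
have down_n k : (k <= n)%N -> A`_(n - k) <= A`_n + k%:R * e.
  elim: k => [|k IHk] h; first by rewrite subn0 mul0r addr0.
  have lt : (n - k.+1 < n)%N by lia.
  have := IHk (ltnW h); have := down _ lt; rewrite (_ : (n - k.+1).+1 = n - k)%N; last by lia.
  rewrite -natr1; lra.
set c := A`_n + 2 * K%:R * e.
have c_ge0 : 0 <= c by apply: addr_ge0; [exact: A_ge0 | rewrite -natrM mulr_ge0 // ler0n].
have near i : (i <= N)%N -> (n <= i + 2 * K)%N -> (i <= n + 2 * K)%N -> A`_i <= c.
  have le_c k : (k <= 2 * K)%N -> A`_n + k%:R * e <= c.
    by move=> hk; rewrite lerD2l ler_wpM2r // -natrM ler_nat.
  move=> le_iN h1 h2; case: (leqP n i) => h.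
    rewrite -(subnKC h); apply: le_trans (up_n _ _) (le_c _ _); lia.
  rewrite -(subKn (ltnW h)); apply: le_trans (down_n _ _) (le_c _ _); lia.
pose P := [pred i : 'I_N.+1 | (n <= i + 2 * K) && (i <= n + 2 * K)]%N.
(* Outside the window (i - n)^2 >= 4 K^2 >= 4 V, so the second summand suffices there; its total is
   at most A(1) / 2 by [Chebyshev]. *)
have S_split : A.[1] <= \sum_(i < N.+1) ((P i)%:R * c + (4 * V)^-1 * ((i%:R - n%:R) ^+ 2 * A`_i)).
  rewrite (horner_coef_wide _ sA); apply: ler_sum => i _; rewrite expr1n mulr1.
  have V4_gt0 : 0 < 4 * V by rewrite mulr_gt0.
  case: (boolP (P i)) => [/andP[h1 h2]|far].
    rewrite mul1r; apply: le_trans (near _ _ h1 h2) _; first by rewrite -ltnS.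
    rewrite lerDl; apply: mulr_ge0; first by rewrite invr_ge0 ltW.
    by apply: mulr_ge0; [exact: sqr_ge0 | exact: A_ge0].
  rewrite mul0r add0r mulrA -[leLHS]mul1r ler_wpM2r // mulrC ler_pdivlMr // mul1r.
  apply: le_trans (_ : (2 * K%:R) ^+ 2 <= _); first by rewrite exprMn -natrX; nra.
  rewrite -[leRHS]real_normK ?num_real // lerXn2r ?nnegrE ?mulr_ge0 //.
  move: far; rewrite /= negb_and -!ltnNge => /orP[] h.
    rewrite distrC ger0_norm ?subr_ge0 ?ler_nat; last by lia.
    by rewrite lerBrDl -natrM -natrD ler_nat ltnW.
  rewrite ger0_norm ?subr_ge0 ?ler_nat; last by lia.
  by rewrite lerBrDl -natrM -natrD ler_nat ltnW.
move: S_split; rewrite big_split /= -mulr_suml -mulr_sumr -natr_sum.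
have -> : (\sum_(i < N.+1) P i)%N = #|P| by rewrite -sum1_card [RHS]big_mkcond; apply: eq_bigr.
have := card_window n (2 * K) N.+1; rewrite -(ler_nat R) -/P => le_P.
have := Chebyshev N n W A W_ge0 A_ge0 W0 sA eqA W1 le_nN; rewrite -/V => cheb S_split.
have le1 : #|P|%:R * c <= (4 * K%:R + 1) * c.
  apply: ler_wpM2r => //; apply: le_trans le_P _.
  by rewrite -natr1 natrD natrM; lra.
have le2 : (4 * V)^-1 * (\sum_(i < N.+1) (i%:R - n%:R) ^+ 2 * A`_i) <= 2^-1 * A.[1].
  have V4_gt0 : 0 < 4 * V by rewrite mulr_gt0.
  by rewrite mulrC ler_pdivrMr //; lra.
lra.
Qed.

End SaddlePoint.

(** * Sign alternation and Hermite polynomials *)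

Section SignAlternation.
Context {R : rcfType}.
Implicit Types (p : {poly R}) (t x : nat -> R).

(* [(-1)^(m + j)] rather than [(-1)^(m - j)] avoids truncated subtraction. *)
Definition alternates p t (m : nat) :=
  (forall j, (j < m)%N -> t j < t j.+1) /\
  (forall j, (j <= m)%N -> 0 < (-1) ^+ (m + j) * p.[t j]).

Lemma chain_lt t m : (forall j, (j < m)%N -> t j < t j.+1) ->
  forall i j, (i < j)%N -> (j <= m)%N -> t i < t j.
Proof.
move=> lt_t i; elim=> // j IHj; rewrite ltnS leq_eqVlt => /orP[/eqP -> | lt_ij] le_jm.
  exact: lt_t.
by apply: lt_trans (IHj lt_ij (ltnW le_jm)) (lt_t _ le_jm).
Qed.

Lemma alternates_roots p t m : alternates p t m ->
  exists x, forall j, (j < m)%N -> [/\ t j < x j, x j < t j.+1 & root p (x j)].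
Proof.
move=> [lt_t sg_p].
suff [x Hx] : {x & forall j, (j < m)%N -> [/\ t j < x j, x j < t j.+1 & root p (x j)]}.
  by exists x.
apply: (@boolp.choice _ _ (fun j y => (j < m)%N -> [/\ t j < y, y < t j.+1 & root p y])).
move=> j; case: (ltnP j m) => [lt_jm|_]; last by exists 0.
have neg : p.[t j] * p.[t j.+1] < 0.
  have := mulr_gt0 (sg_p j (ltnW lt_jm)) (sg_p _ lt_jm).
  have e : (-1) ^+ (m + j) * (-1) ^+ (m + j.+1) = -1 :> R.
    by rewrite addnS exprS mulrCA -expr2 sqrr_sign mulr1.
  by rewrite mulrACA e mulN1r oppr_gt0.
have [y] := poly_ivtoo (ltW (lt_t j lt_jm)) neg.
by rewrite in_itv /= => /andP[h1 h2] rt; exists y.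
Qed.

(** The m sign changes already give m distinct real roots; one more complex root would exceed the
    degree. *)
Lemma alternates_hyperbolic p t m :
  alternates p t m -> (size p <= m.+1)%N ->
  forall z : R[i], root (map_poly (real_complex R) p) z ->
    exists x : R, z = real_complex R x.
Proof.
move=> alt_p sp z rz; have [lt_t sg_p] := alt_p.
have [x Hx] := alternates_roots _ _ _ alt_p.
have p_neq0 : p != 0.
  apply/eqP => p0; have := sg_p m (leqnn m); by rewrite p0 horner0 mulr0 ltxx.
case: (boolP (z \in [seq real_complex R (x j) | j <- iota 0 m])) => [/mapP[j _ ->]|z_notin].
  by exists (x j).
have := @max_poly_roots _ (map_poly (real_complex R) p)
  (z :: [seq real_complex R (x j) | j <- iota 0 m]).
rewrite map_poly_eq0 p_neq0 /= rz z_notin /= size_map_poly size_map size_iota => H.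
suff : (m.+1 < size p)%N by rewrite ltnNge sp.
apply: H => //.
  apply/allP => w /mapP[j]; rewrite mem_iota add0n /= => lt_jm ->.
  by rewrite fmorph_root; case: (Hx j lt_jm).
rewrite map_inj_in_uniq ?iota_uniq // => i j; rewrite !mem_iota !add0n /= => lt_im lt_jm /complexI.
wlog lt_ij : i j lt_im lt_jm / (i < j)%N => [hwlog|] eq_x.
  by case: (ltngtP i j) => // h; [exact: hwlog | apply/esym; exact: hwlog].
have [_ h1 _] := Hx i lt_im; have [h2 _ _] := Hx j lt_jm.
suff : t i.+1 <= t j by rewrite leNgt => /negP[]; rewrite (lt_trans h2) // -eq_x.
move: lt_ij; rewrite leq_eqVlt => /orP[/eqP -> //|h].
by apply/ltW; apply: (chain_lt _ _ lt_t) => //; exact: ltnW.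
Qed.

End SignAlternation.

Section Hermite.
Context {R : rcfType}.

(** The constant terms He_m(0): zero for odd m, and (-1)^k (2k - 1)!! for m = 2k. *)
Fixpoint hermite_coef (m : nat) : R :=
  match m with
  | 0 => 1
  | 1 => 0
  | (k.+1 as j).+1 => - j%:R * hermite_coef k
  end.

Lemma hermite_coefSS k : hermite_coef k.+2 = - k.+1%:R * hermite_coef k.
Proof. by []. Qed.

(* The polynomials [Appell gamma] for sequences [gamma] close to [hermite_coef]
   are small perturbations of the (probabilist's) Hermite polynomials. *)
Definition Appell (gamma : nat -> R) (d : nat) : {poly R} :=
  \poly_(k < d.+1) ('C(d, k)%:R * gamma (d - k)%N).

Lemma coef_Appell gamma d k : (Appell gamma d)`_k = 'C(d, k)%:R * gamma (d - k)%N.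
Proof.
by rewrite coef_poly; case: ltnP => // lt_dk; rewrite bin_small ?mul0r.
Qed.

Local Notation He := (Appell hermite_coef).

Lemma hermite_rec d : He d.+2 = 'X * He d.+1 - d.+1%:R *: He d.
Proof.
apply/polyP => -[|k]; rewrite coefB coefZ coefXM !coef_Appell /=.
  by rewrite !bin0 !subn0 /=; ring.
rewrite !subSS binS natrD mulrDl addrC; congr (_ + _).
case: (ltngtP k d) => [lt_kd|lt_dk|->].
- have e : (d.+1 - k = (d - k.+1).+2)%N by lia.
  have key : (d.+1 * 'C(d, k.+1) = (d - k.+1).+1 * 'C(d.+1, k.+1))%N.
    by rewrite (mul_bin_down d.+1); congr (_ * _)%N; lia.
  rewrite e hermite_coefSS [in RHS]mulrA -[in RHS]natrM key natrM; ring.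
- by rewrite !bin_small ?mul0r ?mulr0 ?oppr0 //; lia.
by rewrite (_ : (d.+1 - d = 1)%N) ?mulr0 ?bin_small ?mul0r ?mulr0 ?oppr0 //; lia.
Qed.

Lemma hermite0 : He 0 = 1.
Proof. by apply/polyP => -[|k]; rewrite coef_Appell coef1 /= ?mulr1 // mul0r. Qed.

Lemma hermite1 : He 1 = 'X.
Proof.
by apply/polyP => -[|[|k]]; rewrite coef_Appell coefX /= ?bin0 ?mulr0 ?mulr1 // bin_small ?mul0r.
Qed.

Lemma size_hermite d : size (He d) = d.+1.
Proof. by rewrite size_poly_eq // subnn mulr1 binn oner_eq0. Qed.

Lemma hermite_monic d : He d \is monic.
Proof. by rewrite monicE lead_coefE size_hermite coef_Appell subnn binn mulr1. Qed.

Lemma hermite_sym d (y : R) : (He d).[- y] = (-1) ^+ d * (He d).[y].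
Proof.
suff [] : (He d).[- y] = (-1) ^+ d * (He d).[y] /\
          (He d.+1).[- y] = (-1) ^+ d.+1 * (He d.+1).[y] by [].
elim: d => [|d [IH1 IH2]].
  by rewrite hermite0 hermite1 !hornerC !hornerX expr0 expr1; split; ring.
split=> //; rewrite hermite_rec !hornerD !hornerN !hornerZ !hornerM !hornerX IH1 IH2 !exprS.
by ring.
Qed.

Lemma hermite_pos d : exists B : R, forall y, B <= y -> 0 < (He d).[y].
Proof.
have lc1 : lead_coef (He d) = 1 by apply/eqP; rewrite -monicE hermite_monic.
have [|B HB] := @poly_pinfty_gt_lc R (He d); first by rewrite lc1.
by exists B => y /HB; rewrite lc1; apply: lt_le_trans.
Qed.

(** At far points -B and B the signs are known from the leading coefficient and parity; they
    complete d + 1 alternating points to d + 3. *)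
Lemma alternates_extend d x :
  (forall i, (i < d)%N -> x i < x i.+1) ->
  (forall i, (i <= d)%N -> 0 < (-1) ^+ (d + i).+1 * (He d.+2).[x i]) ->
  exists t, alternates (He d.+2) t d.+2 /\ forall i, (i <= d)%N -> t i.+1 = x i.
Proof.
move=> lt_x sg_x; have [B0 HB0] := hermite_pos d.+2.
pose B := Num.max B0 (1 + `|x 0%N| + `|x d|).
have B_pos : 0 < (He d.+2).[B] by apply: HB0; rewrite le_max lexx.
have B_ge : 1 + `|x 0%N| + `|x d| <= B by rewrite le_max lexx orbT.
have lt_xB : x d < B.
  by have := ler_norm (x d); have := normr_ge0 (x 0%N); lra.
have lt_Bx : - B < x 0%N.
  by have := ler_norm (- x 0%N); rewrite normrN; have := normr_ge0 (x d); lra.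
exists (fun j => if j is i.+1 then if (i <= d)%N then x i else B else - B).
split; last by move=> i ->.
split=> [[|i]|[|i]] //=.
- move=> lt_id; have le_id : (i <= d)%N by lia.
  rewrite le_id; case: ltnP => h; first exact: lt_x.
  by rewrite (_ : i = d) //; lia.
- by move=> _; rewrite hermite_sym mulrA addn0 -exprMn mulrNN mulr1 expr1n mul1r.
move=> le_i; case: (leqP i d) => [le_id|lt_di].
  have -> : ((d.+2 + i.+1) = (d + i).+1 + 2)%N by lia.
  by rewrite exprD sqrrN expr1n mulr1; exact: sg_x.
have -> : i = d.+1 by lia.
by rewrite addnn -mul2n exprM sqrrN !expr1n mul1r.
Qed.

(** At a root x of He_(d+1) the recurrence reads He_(d+2)(x) = - (d+1) He_d(x), so the alternation
    of He_d at these roots passes to He_(d+2). *)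
Lemma hermite_interlacing d : exists x : nat -> R,
  [/\ forall i, (i < d)%N -> x i < x i.+1,
      forall i, (i <= d)%N -> root (He d.+1) (x i) &
      forall i, (i <= d)%N -> 0 < (-1) ^+ (d + i) * (He d).[x i]].
Proof.
elim: d => [|d [x [lt_x root_x sg_x]]].
  exists (fun=> 0); split=> // i.
    by rewrite hermite1 rootX.
  by rewrite leqn0 => /eqP ->; rewrite hermite0 hornerC mulr1.
have sg2_x i : (i <= d)%N -> 0 < (-1) ^+ (d + i).+1 * (He d.+2).[x i].
  move=> le_id; rewrite hermite_rec hornerD hornerN hornerZ hornerM.
  rewrite (rootP (root_x i le_id)) mulr0 add0r exprS.
  rewrite [X in _ < X](_ : _ = d.+1%:R * ((-1) ^+ (d + i) * (He d).[x i])); last by ring.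
  by rewrite mulr_gt0 ?ltr0n ?sg_x.
have [t [alt_t tx]] := alternates_extend d x lt_x sg2_x.
have [y Hy] := alternates_roots _ _ _ alt_t.
exists y; split=> i le_id.
- have [_ h1 _] := Hy i (leqW le_id); have [h2 _ _] := Hy i.+1 le_id.
  exact: lt_trans h1 h2.
- by have [] := Hy i le_id.
(* The sign at y_i is read off this factorization: the roots x_k with k >= i lie to the right of
   y_i, the others to its left. *)
have defHe : He d.+1 = \prod_(k < d.+1) ('X - (x k)%:P).
  rewrite (@all_roots_prod_XsubC _ (He d.+1) [seq x k | k <- iota 0 d.+1]).
  - by rewrite (monicP (hermite_monic _)) scale1r big_map -val_enum_ord big_map big_enum.
  - by rewrite size_hermite size_map size_iota.
  - apply/allP => w /mapP[k]; rewrite mem_iota add0n /= => lt_kd ->; exact: root_x.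
  rewrite uniq_rootsE map_inj_in_uniq ?iota_uniq // => k l.
  rewrite !mem_iota !add0n /= => lt_k lt_l.
  have inc := chain_lt _ _ lt_x.
  case: (ltngtP k l) => // h eq_x; [have := inc _ _ h | have := inc _ _ h].
    by rewrite eq_x ltxx => /(_ lt_l).
  by rewrite eq_x ltxx => /(_ lt_k).
have [h1 h2 _] := Hy i le_id; have [lt_t _] := alt_t.
have inc := chain_lt _ _ lt_t.
rewrite defHe horner_prod.
have -> : (-1) ^+ (d.+1 + i) = \prod_(k < d.+1) (-1) ^+ (i <= k)%N :> R.
  rewrite prodrXr; set s := (\sum_(k < d.+1) _)%N; have es : (s + i = d.+1)%N.
    rewrite /s -(big_mkord xpredT (fun k => (i <= k)%N : nat)) /= (big_cat_nat (leq0n i) le_id) /=.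
    rewrite big_nat_cond big1 => [|k /andP[/andP[_ lt_ki] _]]; last by rewrite leqNgt lt_ki.
    rewrite add0n big_nat_cond (eq_bigr (fun=> 1%N)) => [|k /andP[/andP[-> _] _]] //.
    by rewrite -big_nat_cond sum_nat_const_nat muln1 subnK.
  by rewrite -es -addnA addnn exprD -mul2n exprM sqrrN !expr1n mulr1.
rewrite -big_split /=; apply: prodr_gt0 => k _; rewrite hornerXsubC -tx ?leq_ord //.
case: (leqP i k) => h.
  have : t i.+1 <= t k.+1.
    move: h; rewrite leq_eqVlt => /orP[/eqP ->//|h]; by apply/ltW/inc; have := ltn_ord k; lia.
  rewrite expr1; lra.
have : t k.+1 <= t i.
  move: h; rewrite leq_eqVlt => /orP[/eqP ->//|h]; by apply/ltW/inc; have := ltn_ord k; lia.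
rewrite expr0; lra.
Qed.

Lemma hermite_alternates d : exists t, alternates (He d) t d.
Proof.
case: d => [|[|d]].
- exists (fun=> 0); split=> // j; rewrite leqn0 => /eqP ->.
  by rewrite hermite0 hornerC mulr1.
- exists (fun j => 2 * j%:R - 1); split=> [[|//] _|]; first by lra.
  move=> [|[|//]] _; rewrite hermite1 hornerX ?addn0 ?expr1 ?sqrrN ?expr1n; lra.
have [x [lt_x root_x sg_x]] := hermite_interlacing d.
have [|t [alt_t _]] := alternates_extend d x lt_x; last by exists t.
move=> i le_id; rewrite hermite_rec hornerD hornerN hornerZ hornerM.
rewrite (rootP (root_x i le_id)) mulr0 add0r exprS.
rewrite [X in _ < X](_ : _ = d.+1%:R * ((-1) ^+ (d + i) * (He d).[x i])); last by ring.
by rewrite mulr_gt0 ?ltr0n ?sg_x.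
Qed.

(** Strict signs at finitely many points survive small changes of the coefficients. *)
Lemma hermite_alternates_stable d : exists t tau, 0 < tau /\
  forall gamma, (forall m, (m <= d)%N -> `|gamma m - hermite_coef m| <= tau) ->
    alternates (Appell gamma d) t d.
Proof.
have [t [lt_t sg_t]] := hermite_alternates d; exists t.
pose C j := (1 + `|t j|) ^+ d; pose v j := (-1) ^+ (d + j) * (He d).[t j].
have v_gt0 j : (j < d.+1)%N -> 0 < v j by exact: sg_t.
have C_ge0 j : 0 <= C j by rewrite exprn_ge0 // addr_ge0.
(* C_j bounds the change at t_j per unit change of gamma. As r dominates every C_j / v_j, tau = 1 /
   (1 + r) gives tau C_j < v_j for all j. *)
pose r := \sum_(j < d.+1) C j / v j.
have r_ge0 : 0 <= r by apply: sumr_ge0 => j _; rewrite divr_ge0 ?C_ge0 // ltW ?v_gt0.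
exists (1 + r)^-1; split; first by rewrite invr_gt0; lra.
move=> gamma le_gamma; split=> // j le_jd.
have C_lt : (1 + r)^-1 * C j < v j.
  rewrite mulrC ltr_pdivrMr; last by lra.
  rewrite mulrC -ltr_pdivrMr ?v_gt0 //; apply: le_lt_trans (_ : r < _); last by lra.
  rewrite /r (bigD1 (Ordinal (le_jd : (j < d.+1)%N))) //= lerDl; apply: sumr_ge0 => k _.
  by rewrite divr_ge0 ?C_ge0 // ltW ?v_gt0.
have : `|(Appell gamma d).[t j] - (He d).[t j]| <= (1 + r)^-1 * C j.
  rewrite !horner_poly -sumrB /C exprDn mulr_sumr.
  apply: le_trans (ler_norm_sum _ _ _) _; apply: ler_sum => k _.
  rewrite expr1n mul1r -mulrBl -mulrBr !normrM normrX normr_nat.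
  rewrite -(mulr_natl (`|t j| ^+ k)) [leRHS]mulrCA -mulrA.
  rewrite ler_wpM2l ?ler0n // ler_wpM2r ?exprn_ge0 //.
  exact/le_gamma/leq_subr.
move=> le_diff.
have : `|(-1) ^+ (d + j) * (Appell gamma d).[t j] - v j| < v j.
  by rewrite -mulrBr normrM normrX normrN1 expr1n mul1r (le_lt_trans le_diff).
by rewrite ltr_norml => /andP[h _]; lra.
Qed.

End Hermite.

(** * Size of the weights *)

Section Estimates.
Context {R : realType}.
Implicit Types (r alpha eta : R).

(** Errors of size eta accumulate over at most d steps, each with amplification depending on the
    index alone; so K is uniform in beta and eta. *)
Lemma hermite_coef_stable d : exists2 K : R, 0 <= K &
  forall (beta : nat -> R) eta, 0 <= eta <= 1 -> beta 0%N = 1 -> `|beta 1%N| <= eta ->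
  (forall k, (k.+2 <= d)%N ->
    `|beta k.+2 + k.+1%:R * beta k| <= eta * (k.+1%:R * `|beta k.+1| + 1)) ->
  forall m, (m <= d)%N -> `|beta m - hermite_coef m| <= K * eta.
Proof.
pose hyp m (beta : nat -> R) eta := [/\ 0 <= eta <= 1, beta 0%N = 1, `|beta 1%N| <= eta &
  forall k, (k.+2 <= m)%N -> `|beta k.+2 + k.+1%:R * beta k| <= eta * (k.+1%:R * `|beta k.+1| + 1)].
pose bnd m (K : R) := 0 <= K /\
  forall beta eta, hyp m beta eta -> `|beta m - hermite_coef m| <= K * eta.
have bnds m : (exists K, bnd m K) /\ (exists K, bnd m.+1 K).
  elim: m => [|m [[K1 [K1_ge0 HK1]] [K2 [K2_ge0 HK2]]]].
    split; [exists 0|exists 1]; split=> // beta eta [/andP[eta_ge0 _] b0 b1 _] /=.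
      by rewrite b0 subrr normr0 mul0r.
    by rewrite subr0 mul1r.
  split; first by exists K2.
  set h := `|hermite_coef m.+1 : R|; set q : R := m.+1%:R.
  have h_ge0 : 0 <= h by exact: normr_ge0.
  have q_ge0 : 0 <= q by exact: ler0n.
  exists (q * K1 + q * (h + K2) + 1); split; first by rewrite !addr_ge0 ?mulr_ge0 ?addr_ge0.
  move=> beta eta Hb; have [/andP[eta_ge0 eta_le1] _ _ /(_ m (leqnn _))] := Hb.
  have Hb' m' : (m' <= m.+2)%N -> hyp m' beta eta.
    by case: Hb => h1 h2 h3 h4 le_m'; split=> // k le_k; apply: h4; exact: leq_trans le_m'.
  have := HK1 _ _ (Hb' _ (leqW (leqnSn m))); have := HK2 _ _ (Hb' _ (leqnSn _)).
  rewrite hermite_coefSS -/q.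
  set x := beta m.+2; set y := beta m.+1; set z := beta m => hy hz hx.
  have hy' : `|y| <= h + K2.
    rewrite -(subrK (hermite_coef m.+1) y) addrC; apply: le_trans (ler_normD _ _) _.
    by rewrite lerD2l (le_trans hy) // ler_piMr.
  have -> : x - - q * hermite_coef m = (x + q * z) - q * (z - hermite_coef m) by ring.
  apply: le_trans (ler_normB _ _) _; rewrite normrM (ger0_norm q_ge0).
  have h1 := ler_wpM2l q_ge0 hz.
  have h2 : eta * (q * `|y| + 1) <= eta * (q * (h + K2) + 1).
    by rewrite ler_wpM2l // lerD2r ler_wpM2l.
  lra.
have [K HK] : {K : nat -> R & forall m, bnd m (K m)}.
  by apply: boolp.choice => m; case: (bnds m).
exists (\sum_(m < d.+1) K m); first by apply: sumr_ge0 => m _; case: (HK m).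
move=> beta eta he b0 b1 brec m le_md; have [_ /(_ beta eta) H] := HK m.
apply: le_trans (H _) _.
  by split=> // k le_km; apply: brec; exact: leq_trans le_md.
case/andP: he => eta_ge0 _; rewrite ler_wpM2r // (bigD1 (Ordinal (le_md : (m < d.+1)%N))) //=.
by rewrite lerDl; apply: sumr_ge0 => i _; case: (HK i).
Qed.

Lemma sum_pow4_half (B : nat) : \sum_(b < B) b.+1%:R ^+ 4 * 2^-1 ^+ b <= 300 :> R.
Proof.
(* Q solves Q(x) - Q(x + 1) / 2 = x^4, so the sum telescopes; Q(1) = 300. *)
pose Q (x : R) := 2 * x ^+ 4 + 8 * x ^+ 3 + 36 * x ^+ 2 + 104 * x + 150.
suff -> : \sum_(b < B) b.+1%:R ^+ 4 * 2^-1 ^+ b = 300 - Q B.+1%:R * 2^-1 ^+ B.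
  by rewrite gerBl mulr_ge0 ?exprn_ge0 ?invr_ge0 // !addr_ge0 ?mulr_ge0 ?exprn_ge0.
elim: B => [|B IHB]; first by rewrite big_ord0 /Q; ring.
rewrite big_ord_recr /= IHB /Q -(natr1 B.+1) [2^-1 ^+ B.+1]exprS.
by move: B.+1%:R (2^-1 ^+ B) => x y; field.
Qed.

(** On the block b L <= k < (b+1) L, r^k is at most 2^(-b), k^j at most ((b+1) L)^j, and sigma sums
    to at most ((b+1) L)^2; j <= 2 keeps the power of b + 1 within four. *)
Lemma sum_sigma_pow_le r (L j N : nat) : (j <= 2)%N -> 0 <= r <= 1 -> (0 < L)%N ->
  r ^+ L <= 2^-1 ->
  \sum_(k < N.+1) k%:R ^+ j * (sigma k)%:R * r ^+ k <= 300 * L%:R ^+ (j + 2).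
Proof.
move=> le_j2 /andP[r_ge0 r_le1] L_gt0 rL.
pose f k : R := k%:R ^+ j * (sigma k)%:R * r ^+ k.
have f_ge0 k : 0 <= f k by rewrite !mulr_ge0 ?exprn_ge0.
have block B : \sum_(0 <= k < B * L) f k <=
    \sum_(b < B) L%:R ^+ (j + 2) * (b.+1%:R ^+ 4 * 2^-1 ^+ b).
  elim: B => [|B IHB]; first by rewrite mul0n big_geq // big_ord0.
  rewrite big_ord_recr /= (@big_cat_nat _ _ _ (B * L)) //=; last by rewrite leq_mul2r leqnSn orbT.
  apply: lerD IHB _.
  apply: (@le_trans _ _ (\sum_(B * L <= k < B.+1 * L)
     ((B.+1 * L)%:R ^+ j * 2^-1 ^+ B * (sigma k)%:R))).
    apply: ler_sum_nat => k /andP[h1 h2]; rewrite /f mulrAC ler_wpM2r //.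
    apply: ler_pM; rewrite ?exprn_ge0 //.
      by rewrite lerXn2r ?nnegrE // ler_nat ltnW.
    apply: le_trans (_ : r ^+ (B * L) <= _); first exact: ler_wiXn2l.
    by rewrite mulnC exprM lerXn2r ?nnegrE ?exprn_ge0 ?invr_ge0.
  rewrite -mulr_sumr -natr_sum.
  have : (\sum_(B * L <= k < B.+1 * L) sigma k <= (B.+1 * L) ^ 2)%N.
    case def_K : (B.+1 * L)%N => [|K]; first by rewrite big_geq.
    apply: leq_trans (_ : (K ^ 2 <= _)%N); last by rewrite leq_exp2r.
    apply: leq_trans (sum_sigma_le K); rewrite -(big_mkord xpredT sigma).
    rewrite [leqRHS](@big_cat_nat _ _ _ (B * L)) ?leq_addl //= -def_K.
    by rewrite leq_mul2r leqnSn orbT.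
  rewrite -(ler_nat R) => h; apply: le_trans (ler_wpM2l _ h) _.
    by rewrite mulr_ge0 ?exprn_ge0 ?invr_ge0.
  rewrite natrX natrM mulrAC -exprD exprMn [leRHS]mulrA ler_wpM2r ?exprn_ge0 ?invr_ge0 //.
  rewrite mulrC ler_wpM2l ?exprn_ge0 // ler_weXn2l ?ler1n //; lia.
apply: le_trans (_ : \sum_(0 <= k < N.+1 * L) f k <= _).
  rewrite -(big_mkord xpredT f) [leRHS](@big_cat_nat _ _ _ N.+1) ?leq_pmulr //=.
  by rewrite lerDl sumr_ge0.
apply: le_trans (block _) _; rewrite -mulr_sumr mulrC ler_wpM2r ?exprn_ge0 //.
exact: sum_pow4_half.
Qed.

Lemma coef_sum_Xn L k : (\sum_(l < L) 'X^l : {poly R})`_k = (k < L)%N%:R.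
Proof.
have -> : \sum_(l < L) 'X^l = \poly_(l < L) 1 :> {poly R}.
  by rewrite poly_def; apply: eq_bigr => l _; rewrite scale1r.
by rewrite coef_poly; case: ifP.
Qed.

Lemma coef_hat_le L i : (hat L : {poly R})`_i <= ((L <= i) && (i < 3 * L))%N%:R.
Proof.
have -> : hat L = 'X^L * (\sum_(k < L) 'X^k + 'X^L * \sum_(k < L) 'X^k) :> {poly R}.
  by rewrite /hat; ring.
rewrite coefXnM; case: ltnP => //= le_Li; rewrite coefD coefXnM !coef_sum_Xn.
case: ltnP => h; first by rewrite addr0 (_ : (i < 3 * L)%N); last by lia.
rewrite add0r ler_nat; case: ltnP => // h'; rewrite (_ : (i < 3 * L)%N) //; lia.
Qed.

Section Weights.
Variables (alpha r : R) (N : nat).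
Hypotheses (alpha_gt0 : 0 < alpha) (r_ge0 : 0 <= r) (r_le1 : r <= 1).

Definition weights : {poly R} := \poly_(k < N.+1) (alpha * (sigma k)%:R * r ^+ k).

Lemma weights_nneg : nneg weights.
Proof.
move=> k; rewrite coef_poly; case: ifP => // _.
by rewrite !mulr_ge0 ?exprn_ge0 // ltW.
Qed.

Lemma coef0_weights : weights`_0 = 0.
Proof. by rewrite coef_poly /= sigma0 mulr0 mul0r. Qed.

(** Used with p = W, theta W and X^2 W'' for j = 0, 1, 2, to bound W(1), W'(1) and W''(1) by orders
    L^2, L^3 and L^4. *)
Lemma weights_moment (j : nat) (p : {poly R}) : (size p <= N.+1)%N ->
  (forall k, (k <= N)%N -> p`_k <= k%:R ^+ j * weights`_k) ->
  forall L, (j <= 2)%N -> (0 < L)%N -> r ^+ L <= 2^-1 ->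
  p.[1] <= 300 * alpha * L%:R ^+ (j + 2).
Proof.
move=> sp le_p L le_j2 L_gt0 rL; rewrite (horner_coef_wide _ sp).
have r01 : 0 <= r <= 1 by rewrite r_ge0.
rewrite -mulrA mulrCA.
apply: le_trans (ler_wpM2l (ltW alpha_gt0) (sum_sigma_pow_le r L j N le_j2 r01 L_gt0 rL)).
rewrite mulr_sumr; apply: ler_sum => k _.
have le_kN : (k <= N)%N by rewrite -ltnS.
rewrite expr1n mulr1; apply: le_trans (le_p k le_kN) _.
by rewrite coef_poly ltn_ord le_eqVlt; apply/orP; left; apply/eqP; ring.
Qed.

Lemma weights_sum L : (0 < L)%N -> r ^+ L <= 2^-1 ->
  weights.[1] <= 300 * alpha * L%:R ^+ 2.
Proof.
move=> L_gt0 rL; apply: (weights_moment 0) => //; first exact: size_poly.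
by move=> k _; rewrite expr0 mul1r.
Qed.

Lemma weights_variance L : (0 < L)%N -> r ^+ L <= 2^-1 ->
  weights^`().[1] <= 300 * alpha * L%:R ^+ 3.
Proof.
move=> L_gt0 rL; rewrite -theta_horner1; apply: (weights_moment 1) => //.
  apply/leq_sizeP => k hk; rewrite coef_theta nth_default ?mulr0 //.
  exact: leq_trans (size_poly _ _) hk.
by move=> k _; rewrite coef_theta expr1.
Qed.

Lemma weights_third L : (0 < L)%N -> r ^+ L <= 2^-1 ->
  weights^`()^`().[1] <= 300 * alpha * L%:R ^+ 4.
Proof.
move=> L_gt0 rL.
have -> : weights^`()^`().[1] = ('X^2 * weights^`()^`()).[1].
  by rewrite hornerM hornerXn expr1n mul1r.
apply: (weights_moment 2) => //.
  apply/leq_sizeP => k hk; rewrite coefXnM; case: ifP => // h.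
  rewrite !coef_deriv (_ : (k - 2).+2 = k)%N; last by lia.
  by rewrite nth_default ?mul0rn // (leq_trans (size_poly _ _) hk).
move=> k _; rewrite coefXnM; case: ltnP => h.
  by rewrite mulr_ge0 ?exprn_ge0 //; exact: weights_nneg.
rewrite !coef_deriv (_ : (k - 2).+2 = k)%N; last by lia.
rewrite -mulrnA -[leLHS]mulr_natl ler_wpM2r //; first exact: weights_nneg.
by rewrite -natrX ler_nat; nia.
Qed.

Section LowerBounds.
Variable L : nat.
Hypotheses (L_gt1 : (1 < L)%N) (le_LN : (3 * L <= N.+1)%N) (rL : 2^-1 < r ^+ L.-1).

(** For L >= 2 an index below 3 L is at most 6 (L - 1), so r^i >= 2^(-6) = 1 / 64. *)
Lemma weights_ge i : (0 < i)%N -> (i < 3 * L)%N -> alpha / 64 * i%:R <= weights`_i.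
Proof.
move=> i_gt0 lt_iL; rewrite coef_poly (leq_trans lt_iL le_LN).
have r64 : 64^-1 <= r ^+ i.
  apply: le_trans (_ : r ^+ (L.-1 * 6) <= _); last by rewrite ler_wiXn2l //; lia.
  rewrite exprM (_ : 64^-1 = 2^-1 ^+ 6); last by field.
  by rewrite lerXn2r ?nnegrE ?exprn_ge0 ?invr_ge0 // ltW.
rewrite -mulrA [leRHS]mulrAC -[leRHS]mulrA ler_wpM2l ?(ltW alpha_gt0) //.
have : (i%:R : R) <= (sigma i)%:R by rewrite ler_nat sigma_ge.
by move=> h; rewrite [leRHS]mulrC mulrC; apply: ler_pM => //; rewrite invr_ge0.
Qed.

(** [hat L] has coefficients at most 1, supported in [L, 3 L), where the weights are at least
    linear: m + 1 smoothing factors fit under them. *)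
Lemma weights_ge_hat c m : 0 <= c -> m.+1%:R * c <= alpha / 64 ->
  forall i, m.+1%:R * c * (theta (hat L))`_i <= weights`_i.
Proof.
move=> c_ge0 le_c i; rewrite coef_theta.
have := coef_hat_le L i; case: (boolP (_ && _)%N) => [/andP[h1 h2] hat_le|_ hat_le]; last first.
  apply: le_trans (weights_nneg i); apply: mulr_ge0_le0; first by rewrite mulr_ge0.
  by apply: mulr_ge0_le0.
have i_gt0 : (0 < i)%N by lia.
apply: le_trans (weights_ge i i_gt0 h2).
apply: ler_pM => //; rewrite ?mulr_ge0 //; first exact: hat_nneg.
by rewrite -[leRHS]mulr1 ler_wpM2l.
Qed.

Lemma weights_variance_ge : alpha / 64 * L%:R ^+ 3 <= weights^`().[1].
Proof.
rewrite -theta_horner1.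
pose p : {poly R} := (alpha / 64 * L%:R ^+ 2) *: ('X^L * \sum_(i < L) 'X^i).
have -> : alpha / 64 * L%:R ^+ 3 = p.[1].
  by rewrite hornerZ hornerM geometric1 hornerXn expr1n; ring.
apply: ler_horner1 => i; rewrite coefZ coef_theta.
have w_ge0 : 0 <= i%:R * weights`_i by rewrite mulr_ge0 //; exact: weights_nneg.
rewrite coefXnM coef_sum_Xn; case: ltnP => h; first by rewrite mulr0.
case: ltnP => h'; last by rewrite mulr0.
have i_gt0 : (0 < i)%N by lia.
have lt_i : (i < 3 * L)%N by lia.
apply: le_trans (ler_wpM2l (ler0n R i) (weights_ge i i_gt0 lt_i)).
rewrite mulr1 [leRHS]mulrCA -expr2 ler_wpM2l ?divr_ge0 ?(ltW alpha_gt0) //.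
by rewrite lerXn2r ?nnegrE // ler_nat.
Qed.

End LowerBounds.
End Weights.
End Estimates.

(** * Convergence to the Hermite polynomials *)

Section LocalLimit.
Context {R : realType}.
Implicit Types (A T W : {poly R}) (alpha v E eta tau c l : R).

Lemma central_coef_ge N n W A T v E :
  nneg W -> nneg A -> nneg T -> W`_0 = 0 -> (size A <= N.+1)%N ->
  eqXn N (theta A) (W * A) -> W.[1] = n%:R -> (n + n ^ 2 <= N)%N ->
  W = W.[1]%:P - W^`().[1] *: (1 - 'X) + T * (1 - 'X) ^+ 2 ->
  W^`().[1] = v ^+ 2 -> 1 <= v ->
  (forall j, (j <= N)%N -> `|((1 - 'X) ^+ 2 * A)`_j| <= 2 * (E / v) ^+ 3 * A.[1]) ->
  144 * E ^+ 3 * (T.[1] / v ^+ 3) <= 2^-1 ->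
  A.[1] <= 36 * v * A`_n.
Proof.
move=> W_ge0 A_ge0 T_ge0 W0 sA eqA W1 le_nN defW Vv v_ge1 le_b small.
(* Then v <= K <= 2 v: the window has the width of a standard deviation. *)
pose K := (Num.trunc v).+1.
have v_gt0 : 0 < v by lra.
have /andP[K1 K2] := truncn_itv (ltW v_gt0).
have K3 : K%:R <= 2 * v by rewrite /K -natr1; lra.
have V_gt0 : 0 < W^`().[1] by rewrite Vv exprn_gt0.
have V_le : W^`().[1] <= K%:R ^+ 2 by rewrite Vv lerXn2r ?nnegrE ?ler0n ?(ltW v_gt0) ?(ltW K2).
have := central_coef_bound N n K W A T _ W_ge0 A_ge0 T_ge0 W0 sA eqA W1 le_nN defW
  V_gt0 le_b V_le.
set e := T.[1] * _ / _ => bnd.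
have A1_ge0 := horner1_ge0 _ A_ge0; have T1_ge0 := horner1_ge0 _ T_ge0.
have e_eq : v ^+ 2 * e = 2 * E ^+ 3 * (T.[1] / v ^+ 3) * A.[1].
  by rewrite /e Vv expr_div_n; field; rewrite lt0r_neq0.
have An_ge0 := A_ge0 n.
have e_ge0 : 0 <= e.
  by apply: divr_ge0; [apply: mulr_ge0 => //; exact: le_trans (le_b 0%N (leq0n N)) | exact: ltW].
have K_ge0 : 0 <= K%:R :> R by exact: ler0n.
have h1 : A`_n + 2 * K%:R * e <= A`_n + 4 * v * e by nra.
have h2 : 2 * (4 * K%:R + 1) <= 18 * v by lra.
have h3 : A.[1] <= 18 * v * (A`_n + 4 * v * e).
  apply: le_trans bnd _; apply: ler_pM => //; first by lra.
  by apply: addr_ge0 => //; apply: mulr_ge0 => //; lra.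
(* The error carries at most half of A(1); moving it to the left doubles 18 to 36. *)
have h4 : 72 * (v ^+ 2 * e) <= 2^-1 * A.[1].
  rewrite e_eq; have := ler_wpM2r A1_ge0 small; lra.
lra.
Qed.

(** At the index n = W(1) the drift of [diff_rec] vanishes. After scaling there remains the Hermite
    recurrence, up to a multiple of g_(k+1) / v and a third-order term of size T(1) / v^3; 72 is 2 *
    36. *)
Lemma normalized_diff_rec d N n W A T v E eta (D := fun m => ((1 - 'X) ^+ m * A)`_n) 
    (g := fun m => (- v) ^+ m * D m / A`_n) :
  nneg T -> eqXn N (theta A) (W * A) -> W.[1] = n%:R -> (n <= N)%N ->
  W = W.[1]%:P - W^`().[1] *: (1 - 'X) + T * (1 - 'X) ^+ 2 ->
  W^`().[1] = v ^+ 2 -> 0 < v -> 1 <= E -> 0 < A`_n -> A.[1] <= 36 * v * A`_n ->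
  (forall m j, (m <= d.+2)%N -> (j <= N)%N ->
     `|((1 - 'X) ^+ m * A)`_j| <= 2 * (E / v) ^+ m.+1 * A.[1]) ->
  v^-1 <= eta -> 72 * E ^+ d.+3 * (T.[1] / v ^+ 3) <= eta ->
  [/\ g 0%N = 1, `|g 1%N| <= eta & forall k, (k.+2 <= d)%N ->
    `|g k.+2 + k.+1%:R * g k| <= eta * (k.+1%:R * `|g k.+1| + 1)].
Proof.
move=> T_ge0 eqA W1 le_nN defW Vv v_gt0 E_ge1 An_gt0 A1_le le_D v_eta T_eta.
have v_neq0 : v != 0 by rewrite lt0r_neq0.
have An_neq0 : A`_n != 0 by rewrite lt0r_neq0.
have T1_ge0 := horner1_ge0 _ T_ge0.
have E_ge0 : 0 <= E by lra.
have err k : (k <= d.+1)%N ->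
    v ^+ k * `|(T * ((1 - 'X) ^+ k.+1 * A))`_n| <= v ^+ 2 * eta * A`_n.
  move=> le_kd.
  have bnd : `|(T * ((1 - 'X) ^+ k.+1 * A))`_n| <= T.[1] * (2 * (E / v) ^+ k.+2 * A.[1]).
    by apply: (coefM_bound N) => // i; exact: le_D.
  have vk_ge0 : 0 <= v ^+ k by rewrite exprn_ge0 // ltW.
  apply: le_trans (ler_wpM2l vk_ge0 bnd) _.
  have coef_ge0 : 0 <= 2 * (E / v) ^+ k.+2 by rewrite mulr_ge0 // exprn_ge0 // divr_ge0 // ltW.
  apply: le_trans (ler_wpM2l vk_ge0 (ler_wpM2l T1_ge0 (ler_wpM2l coef_ge0 A1_le))) _.
  have -> : v ^+ k * (T.[1] * (2 * (E / v) ^+ k.+2 * (36 * v * A`_n))) =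
      v ^+ 2 * (72 * E ^+ k.+2 * (T.[1] / v ^+ 3)) * A`_n.
    rewrite expr_div_n -[k.+2]addn2 (exprD v k 2).
    move: (E ^+ (k + 2)) (v ^+ k) (expf_neq0 k v_neq0) => e w w_neq0.
    by field; rewrite v_neq0 w_neq0.
  rewrite ler_wpM2r ?(ltW An_gt0) // ler_wpM2l ?exprn_ge0 ?(ltW v_gt0) //.
  apply: le_trans T_eta; rewrite ler_wpM2r ?divr_ge0 ?exprn_ge0 ?(ltW v_gt0) //.
  by rewrite ler_wpM2l // ler_weXn2l.
have v2_gt0 : 0 < v ^+ 2 by rewrite exprn_gt0.
split.
- by rewrite /g /D !expr0 !mul1r divff.
- have := diff_rec1 N W A T _ _ defW eqA _ le_nN.
  rewrite W1 subrr mul0r add0r Vv -/(D 1%N) => rec.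
  have := err 1%N isT; rewrite expr1 -rec normrM (ger0_norm (ltW v2_gt0)) => h.
  rewrite /g expr1 !normrM normrN (gtr0_norm v_gt0) normfV (gtr0_norm An_gt0).
  by rewrite ler_pdivrMr // -(ler_pM2l v2_gt0) [leLHS]mulrCA [leRHS]mulrA.
move=> k le_kd; have le_kN := err k.+2 (leqW le_kd).
have := diff_rec N W A T _ _ defW eqA k _ le_nN.
rewrite W1 subrr mul0r sub0r Vv -/(D k.+2) -/(D k.+1) -/(D k) => rec.
have -> : g k.+2 + k.+1%:R * g k =
    - (k.+1%:R * (g k.+1 / v)) + (- v) ^+ k * (T * ((1 - 'X) ^+ k.+3 * A))`_n / A`_n.
  have -> : (T * ((1 - 'X) ^+ k.+3 * A))`_n =
            v ^+ 2 * D k.+2 + k.+1%:R * (D k - D k.+1) by rewrite rec; ring.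
  by rewrite /g !exprS; field; rewrite v_neq0 An_neq0.
apply: le_trans (ler_normD _ _) _; rewrite normrN mulrDr mulr1; apply: lerD.
  rewrite (normrM k.+1%:R) normr_nat (normrM (g k.+1)) normfV (gtr0_norm v_gt0).
  by rewrite [leRHS]mulrCA ler_wpM2l // mulrC ler_wpM2r.
rewrite !normrM normfV (gtr0_norm An_gt0) normrX normrN (gtr0_norm v_gt0).
rewrite ler_pdivrMr // -(ler_pM2l v2_gt0) [leLHS]mulrA -exprD add2n [leRHS]mulrA.
exact: le_kN.
Qed.

(** With L = l^2, the choice t = 1 / l balances t and 2 / (t lam): each smoothing factor gains
    L^(-3/2), the order of V^(-1/2). *)
Lemma smoothing_constant c l : 0 < c -> 1 <= l ->
  4 / (c * (2 * l ^+ 2)) ^+ 2 + (l^-1 + 2 / (l^-1 * (c * (2 * l ^+ 2)))) / l ^+ 2 <=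
  ((c ^+ 2)^-1 + 1 + c^-1) / l ^+ 3.
Proof.
move=> c_gt0 l_ge1; have l_gt0 : 0 < l by lra.
have [l0 c0] : l != 0 /\ c != 0 by rewrite !lt0r_neq0.
have -> : 4 / (c * (2 * l ^+ 2)) ^+ 2 + (l^-1 + 2 / (l^-1 * (c * (2 * l ^+ 2)))) / l ^+ 2 =
  ((c ^+ 2)^-1 / l + 1 + c^-1) / l ^+ 3.
  by field; rewrite l0 c0.
rewrite ler_wpM2r ?invr_ge0 ?exprn_ge0 ?(ltW l_gt0) // !lerD2r.
by rewrite ler_pdivrMr // ler_peMr // invr_ge0 exprn_ge0 ?(ltW c_gt0).
Qed.

(** With u = y / v, [X^(n+d)] (u - 1 + X)^d A is expanded in two ways: by powers of X it is the
    Jensen polynomial at r (u - 1), by powers of 1 - X the Appell polynomial of the differences, up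
    to scaling. *)
Lemma Appell_jensen A (a : nat -> R) (n d : nat) (r v y : R) :
  A`_(n + d) != 0 -> r != 0 -> v != 0 ->
  (forall j, (j <= n + d)%N -> A`_j = a j * r ^+ j) ->
  (jensen_poly a d n).[r * (y / v - 1)] * (r ^+ n * v ^+ d / A`_(n + d)) =
  (Appell (fun m => (- v) ^+ m * ((1 - 'X) ^+ m * A)`_(n + d) / A`_(n + d)) d).[y].
Proof.
move=> An0 r0 v0 defA; set u := y / v.
pose S := ((((u - 1)%:P + 'X) ^+ d * A) : {poly R})`_(n + d).
have S1 : S = r ^+ n * (jensen_poly a d n).[r * (u - 1)].
  rewrite /S exprDn mulr_suml coef_sum horner_poly mulr_sumr (reindex_inj rev_ord_inj) /=.
  apply: eq_bigr => j _; have le_jd : (j <= d)%N by rewrite -ltnS.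
  rewrite subSS bin_sub // subKn // [in LHS]mulrnAl coefMn -polyC_exp -mulrA coefCM coefXnM.
  rewrite ltnNge (leq_trans (leq_subr _ _) (leq_addl _ _)) /=.
  rewrite (_ : (n + d - (d - j) = n + j)%N); last by lia.
  rewrite defA ?leq_add2l // exprD exprMn -mulr_natl; ring.
have S2 : S * v ^+ d / A`_(n + d) =
  (Appell (fun m => (- v) ^+ m * ((1 - 'X) ^+ m * A)`_(n + d) / A`_(n + d)) d).[y].
  have e : (u - 1)%:P + 'X = u%:P + - (1 - 'X) :> {poly R} by rewrite rmorphB /=; ring.
  rewrite /S e exprDn mulr_suml coef_sum horner_poly !mulr_suml (reindex_inj rev_ord_inj) /=.
  apply: eq_bigr => j _; have le_jd : (j <= d)%N by rewrite -ltnS.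
  rewrite subSS bin_sub // subKn // [in LHS]mulrnAl coefMn -polyC_exp -(mulrA (_%:P)) coefCM.
  have sgnC : ((-1) ^+ (d - j) : {poly R}) = ((-1) ^+ (d - j))%:P.
    by rewrite polyC_exp polyCN polyC1.
  rewrite (exprNn (1 - 'X)) sgnC -(mulrA (_%:P)) coefCM (exprNn v).
  rewrite -[in v ^+ d](subnKC le_jd) (exprD v) /u expr_div_n -mulr_natl.
  move: (v ^+ j) (expf_neq0 j v0) => w w0; field; by rewrite An0 w0.
by rewrite -S2 S1; ring.
Qed.

End LocalLimit.

(** * Choice of the saddle point, of the scale L and of the constants *)

Section Saddle.
Context {R : realType}.
Implicit Types (alpha tau r v : R).

Lemma tilted_log_deriv alpha r N :
  let A : {poly R} := \poly_(j < N.+1) (palpha alpha j * r ^+ j) in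
  eqXn N (theta A) (weights alpha r N * A).
Proof.
move=> A i le_iN; rewrite coef_theta coefM coef_poly ltnS le_iN mulrA palpha_rec mulr_suml.
apply: eq_bigr => k _; have le_ki : (k <= i)%N by rewrite -ltnS.
rewrite !coef_poly !ltnS (leq_trans le_ki le_iN) (leq_trans (leq_subr _ _) le_iN).
have -> : r ^+ i = r ^+ k * r ^+ (i - k) by rewrite -exprD subnKC.
by ring.
Qed.

(** Intermediate values on [0, 1]: at r = 1 the single weight alpha sigma(N) >= alpha N already
    reaches n. *)
Lemma exists_saddle alpha (N n : nat) : 0 < alpha -> (0 < n)%N ->
  n%:R <= alpha * N%:R -> exists r, [/\ 0 < r, r <= 1 & (weights alpha r N).[1] = n%:R].
Proof.
move=> alpha_gt0 n_gt0 le_n.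
pose p : {poly R} := \poly_(k < N.+1) (alpha * (sigma k)%:R) - n%:R%:P.
have p_weights r : p.[r] = (weights alpha r N).[1] - n%:R.
  rewrite hornerD hornerN hornerC !horner_poly; congr (_ - _).
  by apply: eq_bigr => k _; rewrite expr1n mulr1.
have p0 : p.[0] < 0.
  rewrite p_weights horner_poly big1 ?sub0r ?oppr_lt0 ?ltr0n // => -[[|k] hk] _ /=.
    by rewrite sigma0 mulr0 !mul0r.
  by rewrite expr0n mulr0 mul0r.
have p1 : 0 <= p.[1].
  rewrite p_weights subr_ge0 (le_trans le_n) // horner_poly big_ord_recr /= !expr1n !mulr1.
  apply: le_trans (_ : alpha * (sigma N)%:R <= _).
    by rewrite ler_wpM2l ?(ltW alpha_gt0) // ler_nat sigma_ge.
  rewrite lerDr; apply: sumr_ge0 => k _.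
  by rewrite !mulr_ge0 ?(ltW alpha_gt0) ?exprn_ge0.
have [|r /andP[r_ge0 r_le1] /rootP] := @poly_ivtW _ p 0 1 ler01.
  by rewrite (ltW p0).
rewrite p_weights => /eqP.
rewrite subr_eq0 => /eqP pr; exists r; split=> //.
rewrite lt_def r_ge0 andbT; apply/negP => /eqP r0.
have : p.[r] < 0 by rewrite r0.
by rewrite p_weights pr subrr ltxx.
Qed.

(** L is the least exponent with r^L <= 1/2. It is at most K, for r^K > 1/2 would make the weight of
    index K alone exceed n. *)
Lemma exists_half_scale alpha r (N K n : nat) : 0 < alpha -> 0 < r -> r <= 1 ->
  (weights alpha r N).[1] = n%:R -> (K <= N)%N -> 2 * n%:R < alpha * K%:R ->
  exists L, [/\ (0 < L)%N, (L <= K)%N, r ^+ L <= 2^-1 & 2^-1 < r ^+ L.-1].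
Proof.
move=> alpha_gt0 r_gt0 r_le1 W1 le_KN lt_nK.
have rK : r ^+ K <= 2^-1.
  rewrite leNgt; apply/negP => lt_r; move: W1; apply/eqP; rewrite gt_eqF //.
  apply: lt_le_trans (_ : alpha * (sigma K)%:R * r ^+ K <= _); last first.
    rewrite horner_poly (bigD1 (Ordinal (le_KN : (K < N.+1)%N))) //= expr1n mulr1.
    rewrite lerDl; apply: sumr_ge0 => k _.
    by rewrite expr1n mulr1 !mulr_ge0 ?exprn_ge0 ?(ltW alpha_gt0) ?(ltW r_gt0).
  apply: lt_le_trans (_ : alpha * K%:R * 2^-1 <= _); first by lra.
  apply: ler_pM; rewrite ?mulr_ge0 ?invr_ge0 ?(ltW alpha_gt0) ?(ltW lt_r) //.
  by rewrite ler_wpM2l ?(ltW alpha_gt0) // ler_nat sigma_ge.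
have exL : exists k, r ^+ k <= 2^-1 by exists K.
case: (ex_minnP exL) => L rL minL; exists L; split=> //; last 2 first.
- exact: minL.
- case: L rL minL => [|L] rL minL; first by move: rL; rewrite expr0; lra.
  by rewrite ltNge; apply/negP => /minL; rewrite ltnn.
by case: L rL {minL} => [|//]; rewrite expr0 => h; exfalso; lra.
Qed.

Lemma palpha_normalized_diffs alpha (d : nat) tau : 0 < alpha -> 0 < tau ->
  exists n0 : nat, forall n, (n0 <= n)%N -> exists (A : {poly R}) r v,
    [/\ 0 < r, 0 < v, 0 < A`_n,
        forall j, (j <= n)%N -> A`_j = palpha alpha j * r ^+ j &
        forall m, (m <= d)%N ->
          `|(- v) ^+ m * ((1 - 'X) ^+ m * A)`_n / A`_n - hermite_coef m| <= tau].
Proof.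
move=> alpha_gt0 tau_gt0.
pose a64 := alpha / 64; have a64_gt0 : 0 < a64 by rewrite divr_gt0.
(* Up to d + 3 smoothing factors must fit under the weights; c <= 1/2 gives lam <= L <= N + 1. *)
pose c := Num.min 2^-1 (a64 / d.+3%:R).
have c_gt0 : 0 < c by rewrite lt_min invr_gt0 ltr0n divr_gt0 ?ltr0n.
have c_le : c <= 2^-1 by rewrite ge_min lexx.
have c_le_a64 m : (m <= d.+2)%N -> m.+1%:R * c <= a64.
  move=> le_md; apply: le_trans (_ : d.+3%:R * c <= _).
    by rewrite ler_wpM2r ?(ltW c_gt0) // ler_nat.
  by rewrite mulrC -ler_pdivlMr ?ltr0n // ge_min lexx orbT.
(* The constant of [smoothing_constant] times a bound for v / l^3. Here 300 alpha + 1, and below s,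
   stand for the square roots of 300 alpha and of a64. *)
pose E := ((c ^+ 2)^-1 + 1 + c^-1) * (300 * alpha + 1).
have cV_gt0 : 0 < c^-1 by rewrite invr_gt0.
have c2V_gt0 : 0 < (c ^+ 2)^-1 by rewrite invr_gt0 exprn_gt0.
have E_ge1 : 1 <= E by rewrite /E; nra.
have E_gt0 : 0 < E by lra.
pose s := Num.min 1 a64; have s_gt0 : 0 < s by rewrite lt_min ltr01.
have s_le1 : s <= 1 by rewrite ge_min lexx.
have s_le_a64 : s <= a64 by rewrite ge_min lexx orbT.
have [C C_ge0 HC] := @hermite_coef_stable R d.
pose eta := Num.min 1 (tau / (C + 1)).
have eta_gt0 : 0 < eta by rewrite lt_min ltr01 divr_gt0 //; lra.
have eta_le1 : eta <= 1 by rewrite ge_min lexx.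
have eta_half : eta / 2 <= eta by lra.
have eta_half1 : eta / 2 <= 2^-1 by lra.
have C_eta : C * eta <= tau.
  apply: le_trans (_ : (C + 1) * eta <= _); first by rewrite ler_wpM2r ?(ltW eta_gt0) // lerDl.
  by rewrite mulrC -ler_pdivlMr ?ge_min ?lexx ?orbT //; lra.
(* Z / l majorizes both 1 / v and the third-order error, and l > l0 makes it at most eta / 2. *)
pose Z := s^-1 + 144 * E ^+ d.+3 * (150 * alpha / s ^+ 3).
have Ed_ge0 : 0 <= E ^+ d.+3 by rewrite exprn_ge0 // ltW.
have sV_ge0 : 0 <= s^-1 by rewrite invr_ge0 ltW.
have s3_ge0 : 0 <= s ^+ 3 by rewrite exprn_ge0 // ltW.
have Z2_ge0 : 0 <= 144 * E ^+ d.+3 * (150 * alpha / s ^+ 3).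
  apply: mulr_ge0; first exact: mulr_ge0.
  by apply: divr_ge0 => //; apply: mulr_ge0 => //; exact: ltW.
have Z_ge0 : 0 <= Z by exact: addr_ge0.
pose l0 := 1 + 2 * Z / eta.
have l0_ge1 : 1 <= l0 by rewrite lerDl divr_ge0 ?mulr_ge0 ?(ltW eta_gt0).
have [k0 k0_gt] : exists k0 : nat, 2 < alpha * k0%:R.
  exists (Num.bound (2 / alpha)); rewrite mulrC -ltr_pdivrMr //; apply: archi_boundP.
  by rewrite divr_ge0 ?(ltW alpha_gt0).
(* As n = W(1) <= 300 alpha l^4, a large n forces l > l0. *)
have [n1 n1_gt] : exists n1 : nat, 300 * alpha * l0 ^+ 4 < n1%:R.
  exists (Num.bound (300 * alpha * l0 ^+ 4)); apply: archi_boundP.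
  by rewrite !mulr_ge0 ?exprn_ge0 ?(ltW alpha_gt0) // (le_trans ler01).
(* n > 3 k0 gives 3 K = 3 n k0 <= n^2 <= N, so that [hat L] lives below the truncation. *)
exists (n1 + 3 * k0 + 1)%N => n le_n.
have n_gt0 : (0 < n)%N by clear -le_n; lia.
have le_n2 : (n <= n ^ 2)%N by rewrite -[leqLHS]expn1 leq_pexp2l.
have nR_gt0 : 0 < n%:R :> R by rewrite ltr0n.
have [N defN] : exists N, N = (n + n ^ 2)%N by exists (n + n ^ 2)%N.
have [K defK] : exists K, K = (n * k0)%N by exists (n * k0)%N.
have N_gt1 : (1 < N)%N by rewrite defN; clear -n_gt0 le_n2; lia.
have le_2nN : (2 * n <= N.+1)%N by rewrite defN mul2n -addnn; clear -le_n2; lia.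
have le_3KN : (3 * K <= N)%N by rewrite defK defN; clear -le_n; nia.
have le_KN : (K <= N)%N by apply: leq_trans le_3KN; rewrite leq_pmull.
have lt_nK : 2 * n%:R < alpha * K%:R.
  by rewrite defK natrM mulrCA mulrC ltr_pM2l.
have le_nN : n%:R <= alpha * N%:R.
  apply: le_trans (_ : alpha * K%:R <= _); first by clear -lt_nK nR_gt0; lra.
  by rewrite ler_wpM2l ?(ltW alpha_gt0) // ler_nat.
have [r [r_gt0 r_le1 W1]] := @exists_saddle _ N n alpha_gt0 n_gt0 le_nN.
have [L [L_gt0 le_LK rL rL1]] :=
  @exists_half_scale _ _ _ K n alpha_gt0 r_gt0 r_le1 W1 le_KN lt_nK.
set W := weights alpha r N in W1.
pose A : {poly R} := \poly_(j < N.+1) (palpha alpha j * r ^+ j).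
have r_ge0 := ltW r_gt0.
pose l := Num.sqrt (L%:R : R).
have l2 : L%:R = l ^+ 2 by rewrite sqr_sqrtr.
have l_ge0 : 0 <= l by exact: sqrtr_ge0.
have lt_l0l : l0 < l.
  have := weights_sum alpha r N alpha_gt0 r_ge0 r_le1 L L_gt0 rL.
  rewrite -/W W1 l2 => n_le.
  have : n1%:R <= n%:R :> R by rewrite ler_nat; clear -le_n; lia.
  move=> n1_le; rewrite ltNge; apply/negP => le_ll0.
  have : l ^+ 4 <= l0 ^+ 4 by rewrite lerXn2r ?nnegrE // (le_trans ler01).
  rewrite (_ : l ^+ 4 = (l ^+ 2) ^+ 2); last by rewrite -exprM.
  move=> h; have a_gt0 : 0 < 300 * alpha by rewrite mulr_gt0.
  by have := ler_wpM2l (ltW a_gt0) h; clear -n_le n1_le n1_gt; lra.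
have l_ge1 : 1 <= l by exact: le_trans l0_ge1 (ltW lt_l0l).
have l_gt0 : 0 < l by exact: lt_le_trans ltr01 l_ge1.
have L_gt1 : (1 < L)%N.
  by rewrite -(ltr_nat R) l2 expr_gt1 // (le_lt_trans l0_ge1 lt_l0l).
have le_LN : (3 * L <= N.+1)%N.
  by apply/leqW/leq_trans/le_3KN; rewrite leq_mul2l le_LK orbT.
have le_LN1 : (L <= N.+1)%N by apply: leq_trans le_LN; rewrite leq_pmull.
have le_n_N : (n <= N)%N by rewrite defN leq_addr.
have W_ge0 : nneg W by exact: weights_nneg.
have W0 : W`_0 = 0 by exact: coef0_weights.
have A_ge0 : nneg A.
  move=> j; rewrite coef_poly; case: ifP => // _.
  by rewrite mulr_ge0 ?exprn_ge0 // palpha_ge0 // ltW.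
have A0 : A`_0 = 1 by rewrite coef_poly palpha0 mulr1.
have sA : (size A <= N.+1)%N by exact: size_poly.
have eqA : eqXn N (theta A) (W * A) by exact: tilted_log_deriv.
have [T [T_ge0 defW T1]] := @Taylor2_at1 _ W W_ge0.
pose v := Num.sqrt (W^`().[1]).
have V_ge : n%:R <= W^`().[1] by rewrite -W1; exact: deriv1_ge.
have V_ge0 : 0 <= W^`().[1] by exact: le_trans V_ge.
have Vv : W^`().[1] = v ^+ 2 by rewrite sqr_sqrtr.
have v_ge0 : 0 <= v by exact: sqrtr_ge0.
have nR_ge1 : 1 <= n%:R :> R by rewrite ler1n.
have v_ge1 : 1 <= v by rewrite -(@ler_pXn2r _ 2) ?nnegrE // expr1n -Vv (le_trans nR_ge1).
have v_gt0 : 0 < v by exact: lt_le_trans v_ge1.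
have l3_gt0 : 0 < l ^+ 3 by rewrite exprn_gt0.
have v_le : v <= (300 * alpha + 1) * l ^+ 3.
  have a_gt0 : 0 < 300 * alpha by rewrite mulr_gt0.
  rewrite -(@ler_pXn2r _ 2) ?nnegrE //; last first.
    by rewrite mulr_ge0 ?(ltW l3_gt0) // addr_ge0 // ltW.
  rewrite -Vv; apply: le_trans (weights_variance alpha r N alpha_gt0 r_ge0 r_le1 L L_gt0 rL) _.
  rewrite l2 [leRHS]exprMn -!exprM ler_wpM2r ?exprn_ge0 //.
  by clear -a_gt0; nra.
have v_ge : s * l ^+ 3 <= v.
  rewrite -(@ler_pXn2r _ 2) ?nnegrE //; last by rewrite mulr_ge0 ?(ltW l3_gt0) ?(ltW s_gt0).
  rewrite -Vv.
  apply: le_trans (weights_variance_ge alpha r N alpha_gt0 r_ge0 r_le1 L L_gt1 le_LN rL1).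
  rewrite l2 [leLHS]exprMn -!exprM ler_wpM2r ?exprn_ge0 // -/a64.
  by apply: le_trans s_le_a64; rewrite expr2 ler_piMr ?(ltW s_gt0).
have T_le : T.[1] / v ^+ 3 <= 150 * alpha / s ^+ 3 / l.
  have := weights_third alpha r N alpha_gt0 r_ge0 r_le1 L L_gt0 rL.
  rewrite -/W -T1 l2 -exprM => T1_le.
  rewrite ler_pdivrMr ?exprn_gt0 //.
  apply: le_trans (_ : 150 * alpha * l ^+ 8 <= _); first by clear -T1_le; lra.
  have h : (s * l ^+ 3) ^+ 3 <= v ^+ 3.
    by rewrite lerXn2r ?nnegrE // mulr_ge0 ?(ltW l3_gt0) ?(ltW s_gt0).
  have k_ge0 : 0 <= 150 * alpha / s ^+ 3 / l.
    by rewrite !divr_ge0 ?mulr_ge0 ?exprn_ge0 ?(ltW s_gt0) ?(ltW alpha_gt0).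
  apply: le_trans (ler_wpM2l k_ge0 h); rewrite le_eqVlt; apply/orP; left; apply/eqP.
  by field; rewrite !lt0r_neq0.
have Z_l : Z / l <= eta / 2.
  have h : 2 * Z <= l * eta.
    by rewrite -ler_pdivrMr // (le_trans _ (ltW lt_l0l)) // /l0 lerDr.
  by rewrite ler_pdivrMr //; clear -h; lra.
have T1_ge0 : 0 <= T.[1] / v ^+ 3 by rewrite divr_ge0 ?exprn_ge0 //; exact: horner1_ge0.
have lV_ge0 : 0 <= l^-1 by rewrite invr_ge0.
have v_eta : v^-1 <= eta.
  have le_slv : s * l <= v.
    apply: le_trans v_ge; rewrite ler_pM2l // -[leLHS]expr1.
    by rewrite ler_weXn2l.
  apply: le_trans (_ : (s * l)^-1 <= _); first by rewrite lef_pV2 ?posrE ?mulr_gt0.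
  rewrite invfM; apply: le_trans (le_trans Z_l eta_half).
  by rewrite ler_wpM2r // /Z lerDl.
have T_eta : 144 * E ^+ d.+3 * (T.[1] / v ^+ 3) <= eta / 2.
  apply: le_trans Z_l; apply: le_trans (_ : 144 * E ^+ d.+3 * (150 * alpha / s ^+ 3 / l) <= _).
    by rewrite ler_wpM2l // mulr_ge0.
  by rewrite mulrA ler_wpM2r // /Z lerDr.
have le_D m j : (m <= d.+2)%N -> (j <= N)%N ->
    `|((1 - 'X) ^+ m * A)`_j| <= 2 * (E / v) ^+ m.+1 * A.[1].
  move=> le_md le_jN.
  have l_inv : 0 < l^-1 by rewrite invr_gt0.
  have lamN : c * (2 * L%:R) <= N.+1%:R.
    have : (L%:R : R) <= N.+1%:R by rewrite ler_nat.
    have : 0 < L%:R :> R by rewrite ltr0n.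
    clear -c_le; nra.
  have W1N : 2 * W.[1] <= N.+1%:R by rewrite W1 -natrM ler_nat.
  have := diff_coef_bound N L m W A c l^-1 W0 A0 sA eqA c_gt0 l_inv L_gt0 N_gt1 lamN W1N
    (weights_ge_hat alpha r N alpha_gt0 r_ge0 r_le1 L L_gt1 le_LN rL1 c m
       (ltW c_gt0) (c_le_a64 m le_md)) j le_jN.
  move/le_trans; apply; rewrite ler_wpM2r ?horner1_ge0 // ler_wpM2l //.
  have eps_le : 4 / (c * (2 * L%:R)) ^+ 2 + (l^-1 + 2 / (l^-1 * (c * (2 * L%:R)))) / L%:R <= E / v.
    rewrite l2; apply: le_trans (smoothing_constant c l c_gt0 l_ge1) _.
    rewrite ler_pdivrMr // mulrAC ler_pdivlMr // /E -mulrA ler_wpM2l //.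
    by rewrite !addr_ge0 ?ltW.
  have cL_ge0 : 0 <= c * (2 * L%:R) by rewrite !mulr_ge0 ?(ltW c_gt0).
  apply: lerXn2r => //; rewrite nnegrE; last by apply: divr_ge0; exact: ltW.
  apply: addr_ge0; first by apply: divr_ge0 => //; exact: exprn_ge0.
  apply: divr_ge0 => //; apply: addr_ge0 => //; apply: divr_ge0 => //.
  exact: mulr_ge0.
have E3_le : 144 * E ^+ 3 * (T.[1] / v ^+ 3) <= 2^-1.
  apply: le_trans (_ : 144 * E ^+ d.+3 * (T.[1] / v ^+ 3) <= _).
    by rewrite ler_wpM2r // ler_wpM2l // ler_weXn2l.
  exact: le_trans T_eta eta_half1.
have A1_le : A.[1] <= 36 * v * A`_n.
  apply: (central_coef_ge N n W A T v E) => //; first by rewrite defN.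
  by move=> j le_jN; exact: le_D.
have An_gt0 : 0 < A`_n.
  have A1_ge1 : 1 <= A.[1] by have := sum_coef_le 1 _ A_ge0; rewrite big_ord1 A0.
  have v36_gt0 : 0 < 36 * v by rewrite mulr_gt0.
  rewrite -(pmulr_rgt0 _ v36_gt0).
  exact: lt_le_trans ltr01 (le_trans A1_ge1 A1_le).
have T_eta' : 72 * E ^+ d.+3 * (T.[1] / v ^+ 3) <= eta.
  have := mulr_ge0 Ed_ge0 T1_ge0; clear -T_eta eta_half; lra.
have [g0 g1 g_rec] := normalized_diff_rec d N n W A T v E eta T_ge0 eqA W1 le_n_N
  defW Vv v_gt0 E_ge1 An_gt0 A1_le le_D v_eta T_eta'.
have eta01 : 0 <= eta <= 1 by rewrite (ltW eta_gt0).
exists A, r, v; split=> // [j le_jn|m le_md].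
  by rewrite coef_poly ltnS (leq_trans le_jn le_n_N).
exact: le_trans (HC _ _ eta01 g0 g1 g_rec m le_md) C_eta.
Qed.

End Saddle.

Theorem theorem1p3 (R : realType) (alpha : R) (d : nat) :
  0 < alpha ->
  exists N : nat, forall n : nat, (N < n)%N ->
    hyperbolic (jensen_poly (palpha alpha) d n).
Proof.
move=> alpha_gt0.
have [t [tau [tau_gt0 stable]]] := @hermite_alternates_stable R d.
have [n0 Hn0] := palpha_normalized_diffs alpha d tau alpha_gt0 tau_gt0.
exists n0 => n lt_n.
(* The saddle is placed at the top index n + d, where all the differences are taken. *)
have [|A [r [v [r_gt0 v_gt0 An_gt0 defA close]]]] := Hn0 (n + d)%N.
  exact: leq_trans (ltnW lt_n) (leq_addr _ _).
have [lt_t sg_t] := stable _ close.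
have v_neq0 : v != 0 by rewrite lt0r_neq0.
(* The sample points of He_d, carried over by the increasing affine map of [Appell_jensen]. *)
apply: (@alternates_hyperbolic _ _ (fun j => r * (t j / v - 1)) d); last exact: size_poly.
split=> j hj; first by rewrite ltr_pM2l // ltrD2r ltr_pM2r ?invr_gt0 // lt_t.
have scale_gt0 : 0 < r ^+ n * v ^+ d / A`_(n + d).
  by rewrite divr_gt0 // mulr_gt0 // exprn_gt0.
rewrite -(pmulr_lgt0 _ scale_gt0) -(mulrA ((-1) ^+ _)) Appell_jensen ?lt0r_neq0 //.
exact: sg_t.
Qed.
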